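(* Let $M$ be a finite-dimensional connected manifold with corners and let $N$ be a locally convex manifold. Then each continuous map $M\to N$ is homotopic to a smooth map $M\to N$. Furthermore, two smooth maps $f,g\colon M\to N$ are homotopic if and only if they are smoothly homotopic, i.e., if and only if there exists a smooth map $F\colon[0,1]\times M\to N$ with $F(0,\cdot)=f$ and $F(1,\cdot)=g$.
   Context: Locally convex spaces are real Hausdorff locally convex topological vector spaces. Differential calculus: let $X,Y$ be locally convex spaces and $V\subseteq X$ open. A map $f\colon V\to Y$ is $C^1$ if it is continuous, for all $x\in V$, $v\in X$ the limit $df(x).v:=\lim_{h\to0}\frac1h(f(x+hv)-f(x))$ exists, and $df\colon V\times X\to Y$ is continuous. For $n>1$ define recursively $d^nf(x).(v_1,\dots,v_n):=\lim_{h\to0}\frac1h\big(d^{n-1}f(x+hv_n).(v_1,\dots,v_{n-1})-d^{n-1}f(x).(v_1,\dots,v_{n-1})\big)$; $f$ is $C^n$ if $d^kf\colon V\times X^k\to Y$ exists and is continuous for all $k=1,\dots,n$, and smooth if it is $C^n$ for all $n\in\mathbb N$. A locally convex manifold is a Hausdorff space in which each point has a neighbourhood homeomorphic to an open subset of some locally convex space, such that the coordinate changes are smooth (together with a fixed such differentiable structure). A ($d$-dimensional, finite-dimensional) manifold with corners is a paracompact Hausdorff space in which each point has a neighbourhood homeomorphic to an open subset of $\mathbb R^d_+=\{x\in\mathbb R^d: x_i\ge0 \text{ for all } i\}$, with smooth coordinate changes. Here a map $f\colon A\subseteq\mathbb R^n\to\mathbb R^m$ is smooth if each $x\in A$ has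 an open neighbourhood $U_x$ in $\mathbb R^n$ and a smooth map $f_x\colon U_x\to\mathbb R^m$ with $f_x=f$ on $A\cap U_x$. More generally, a continuous map from a (not necessarily open) domain with dense interior in a locally convex space into a locally convex space is smooth if it is smooth on the interior and all its differentials $d^nf$ extend continuously to the boundary; smooth maps on manifolds with corners are defined in charts accordingly. The product $[0,1]\times M$ is again a manifold with corners. Two maps are homotopic if there is a continuous homotopy $[0,1]\times M\to N$ between them. *)

(* Defs.v *)
From HB Require Import structures.
From mathcomp Require Import all_boot all_order all_algebra.
From mathcomp Require Import all_classical all_reals all_analysis.
Import Order.TTheory GRing.Theory Num.Theory.
Import numFieldNormedType.Exports.

Set Implicit Arguments.
Unset Strict Implicit.
Unset Printing Implicit Defensive.

Local Open Scope classical_set_scope.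
Local Open Scope ring_scope.

(* A locally convex space over [R : realType] is an [X : tvsType R] (local
   convexity is part of this structure) satisfying [hausdorff_space X].
   A partial map defined on a subset of [X] is represented by a total function,
   whose values outside of that subset are never relevant. *)

Section differential_calculus.
Context {R : realType} {X Y : tvsType R}.
Implicit Types (f : X -> Y) (A V : set X) (n : nat).

Definition diff_quotient f (x v : X) (h : R) : Y := h^-1 *: (f (x + h *: v) - f x).

(* The limit of g(h) as h tends to 0, with h <> 0, and 0 if there is none; it
   is unique when Y is Hausdorff.  The library's [lim] requires a pointed type,
   which a [tvsType] is not. *)
Definition lim0 (g : R -> Y) : Y := xget 0 [set l | g h @[h --> 0^'] --> l].

(* [ndiff f n x v] is d^n f(x).(v_1, ..., v_n), with d^0 f = f. *)
Fixpoint ndiff f n : X -> ('I_n -> X) -> Y :=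
  match n with
  | 0 => fun x _ => f x
  | n'.+1 => fun x v => lim0 (diff_quotient
      (fun y => ndiff f y (fun i => v (widen_ord (leqnSn n') i))) x (v ord_max))
  end.

(* For v : 'I_n.+1 -> X, the limit defining d^(n+1) f(x).v exists. *)
Definition ndiff_exists f n (x : X) (v : 'I_n.+1 -> X) : Prop :=
  exists l : Y, diff_quotient
    (fun y => ndiff f y (fun i => v (widen_ord (leqnSn n) i))) x (v ord_max) h
      @[h --> 0^'] --> l.

(* X^n with the product topology *)
Definition ndiff_uncurry f n (p : X * {ptws 'I_n -> X}) : Y := ndiff f p.1 p.2.

(* f is C^n on the open set V *)
Definition Cn_on n V f : Prop :=
  {within V, continuous f} /\
  forall k, (k < n)%N ->
    (forall x (v : 'I_k.+1 -> X), V x -> ndiff_exists f x v) /\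
    {within V `*` setT, continuous (@ndiff_uncurry f k.+1)}.

(* f is smooth on the open set V *)
Definition smooth_on V f : Prop := forall n, Cn_on n V f.

(* f is smooth on the set A, which has dense interior but need not be open *)
Definition smooth_dense_interior A f : Prop :=
  [/\ {within A, continuous f},
      smooth_on A° f &
      forall n, exists2 g : X * {ptws 'I_n -> X} -> Y,
        {within A `*` setT, continuous g} &
        forall p, A° p.1 -> g p = ndiff_uncurry f p].

End differential_calculus.

(* f : A -> R^m, with A an arbitrary subset of R^n, is smooth if it locally
   extends to smooth maps on open subsets of R^n. *)
Definition smooth_extendable (R : realType) n m (A : set 'rV[R]_n)
    (f : 'rV[R]_n -> 'rV[R]_m) : Prop :=
  forall x, A x -> exists (U : set 'rV[R]_n) (fx : 'rV[R]_n -> 'rV[R]_m),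
    [/\ open U, U x, smooth_on U fx & {in A `&` U, fx =1 f}].

(* A chart of T with values in E: a homeomorphism from an open subset of T onto
   a subset of E.  [chart_inv] is only relevant on the image. *)
Record chart (T E : topologicalType) := Chart {
  chart_dom : set T;
  chart_map : T -> E;
  chart_inv : E -> T }.

Definition chart_img (T E : topologicalType) (c : chart T E) : set E :=
  chart_map c @` chart_dom c.

Definition is_chart (T E : topologicalType) (c : chart T E) : Prop :=
  [/\ open (chart_dom c),
      {in chart_dom c, cancel (chart_map c) (chart_inv c)},
      {within chart_dom c, continuous (chart_map c)} &
      {within chart_img c, continuous (chart_inv c)}].

(* The expression e o f o c^-1 of f in the charts c and e, and its domain *)
Section local_representative.
Context {T S E F : topologicalType}.
Variables (f : T -> S) (c : chart T E) (e : chart S F).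

Definition local_rep : E -> F := chart_map e \o f \o chart_inv c.

Definition local_dom : set E :=
  chart_img c `&` (f \o chart_inv c) @^-1` chart_dom e.

End local_representative.

(* The atlas of a locally convex manifold; the model space may depend on the
   chart, so that there is a set of charts for each model space. *)
Definition is_lc_atlas (R : realType) (T : topologicalType)
    (A : forall E : tvsType R, set (chart T E)) : Prop :=
  [/\ (forall E c, A E c ->
         [/\ hausdorff_space E, is_chart c & open (chart_img c)]),
      (forall x, exists E, exists2 c, A E c & chart_dom c x) &
      (forall E F c e, A E c -> A F e ->
         smooth_on (local_dom idfun c e) (local_rep idfun c e))].

Record lc_manifold (R : realType) := LCManifold {
  lcm_space :> topologicalType;
  lcm_atlas : forall E : tvsType R, set (chart lcm_space E);
  lcm_hausdorff : hausdorff_space lcm_space;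
  lcm_atlasP : is_lc_atlas lcm_atlas }.

Arguments lcm_atlas {R} N E _ : rename.

Definition locally_finite (T : topologicalType) (V : set_system T) : Prop :=
  forall x : T, exists2 W, nbhs x W & finite_set [set B | V B /\ B `&` W !=set0].

Definition open_cover (T : topologicalType) (U : set_system T) : Prop :=
  U `<=` open /\ \bigcup_(B in U) B = setT.

Definition paracompact (T : topologicalType) : Prop :=
  forall U : set_system T, open_cover U -> exists V : set_system T,
    [/\ open_cover V, locally_finite V &
        forall B, V B -> exists2 C, U C & B `<=` C].

(* R^d_+ *)
Definition orthant (R : realType) d : set 'rV[R]_d :=
  [set x : 'rV[R]_d | forall i, 0 <= x ord0 i].

Arguments orthant R d _ : clear implicits.

Definition is_corner_atlas (R : realType) d (T : topologicalType)
    (A : set (chart T 'rV[R]_d)) : Prop :=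
  [/\ (forall c, A c -> is_chart c /\
         exists2 O : set 'rV[R]_d, open O & chart_img c = O `&` orthant R d),
      (forall x, exists2 c, A c & chart_dom c x) &
      (forall c e, A c -> A e ->
         smooth_extendable (local_dom idfun c e) (local_rep idfun c e))].

Record corner_manifold (R : realType) := CornerManifold {
  cm_space :> topologicalType;
  cm_dim : nat;
  cm_atlas : set (chart cm_space 'rV[R]_cm_dim);
  cm_hausdorff : hausdorff_space cm_space;
  cm_paracompact : paracompact cm_space;
  cm_atlasP : is_corner_atlas cm_atlas }.

Arguments cm_atlas {R} M _ : rename.

(* Smoothness, in charts, of a map from a space T with atlas A modelled on
   R^d_+ to a locally convex manifold.  The sets [local_dom f c e] are open in
   R^d_+, hence have dense interior in R^d. *)
Definition smooth_map (R : realType) d (T : topologicalType)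
    (A : set (chart T 'rV[R]_d)) (N : lc_manifold R) (f : T -> N) : Prop :=
  continuous f /\
  forall (E : tvsType R) c (e : chart N E), A c -> lcm_atlas N E e ->
    smooth_dense_interior (local_dom f c e) (local_rep f c e).

(* The product of two manifolds with corners, using
   R^d1_+ x R^d2_+ = R^(d1 + d2)_+ *)
Section product_atlas.
Context {R : realType} {d1 d2 : nat} {T1 T2 : topologicalType}.

Definition prod_chart (c1 : chart T1 'rV[R]_d1) (c2 : chart T2 'rV[R]_d2) :
    chart (T1 * T2)%type 'rV[R]_(d1 + d2) := {|
  chart_dom := chart_dom c1 `*` chart_dom c2;
  chart_map := fun p => row_mx (chart_map c1 p.1) (chart_map c2 p.2);
  chart_inv := fun y => (chart_inv c1 (lsubmx y), chart_inv c2 (rsubmx y)) |}.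

Definition prod_atlas (A1 : set (chart T1 'rV[R]_d1))
    (A2 : set (chart T2 'rV[R]_d2)) : set (chart (T1 * T2)%type 'rV[R]_(d1 + d2)) :=
  [set c | exists c1 c2, [/\ A1 c1, A2 c2 & c = prod_chart c1 c2]].

End product_atlas.

Section unit_interval.
Variable R : realType.

Definition unit_itv : topologicalType := set_type `[0 : R, 1].

Definition itv_val (t : unit_itv) : R := set_val t.

Fact unit_itv0_subproof : (0 : R) \in (`[0, 1]%classic : set R).
Proof. by rewrite inE /= in_itv /= lexx ler01. Qed.

Fact unit_itv1_subproof : (1 : R) \in (`[0, 1]%classic : set R).
Proof. by rewrite inE /= in_itv /= lexx ler01. Qed.

Definition itv0 : unit_itv := exist _ 0 unit_itv0_subproof.
Definition itv1 : unit_itv := exist _ 1 unit_itv1_subproof.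

Definition to_unit_itv (r : R) : unit_itv := insubd itv0 r.

(* The manifold with corners [0,1]: t |-> t on [0,1[ and t |-> 1 - t on ]0,1] *)
Definition itv_chart0 : chart unit_itv 'rV[R]_1 := {|
  chart_dom := [set t : unit_itv | itv_val t < 1];
  chart_map := fun t => const_mx (itv_val t);
  chart_inv := fun y => to_unit_itv (y ord0 ord0) |}.

Definition itv_chart1 : chart unit_itv 'rV[R]_1 := {|
  chart_dom := [set t : unit_itv | 0 < itv_val t];
  chart_map := fun t => const_mx (1 - itv_val t);
  chart_inv := fun y => to_unit_itv (1 - y ord0 ord0) |}.

Definition itv_atlas : set (chart unit_itv 'rV[R]_1) :=
  [set itv_chart0; itv_chart1].

End unit_interval.

Arguments itv_atlas R _ : clear implicits.

Definition homotopic (R : realType) (M N : topologicalType) (f g : M -> N) : Prop :=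
  exists F : unit_itv R * M -> N,
    [/\ continuous F, (forall x, F (itv0 R, x) = f x) &
        forall x, F (itv1 R, x) = g x].

Definition smoothly_homotopic (R : realType) (M : corner_manifold R)
    (N : lc_manifold R) (f g : M -> N) : Prop :=
  exists F : unit_itv R * M -> N,
    [/\ smooth_map (prod_atlas (itv_atlas R) (cm_atlas M)) F,
        (forall x, F (itv0 R, x) = f x) &
        forall x, F (itv1 R, x) = g x].

(* Main.v *)
(* The continuous map, seen as a map on the cylinder [0,1] x M, is made smooth by
   countably many local modifications.  In a chart e of N around the image of a
   compact set W, replace e o f successively by (1 - b_i) e o f + b_i y_i, where
   the b_i are smooth bump functions supported in small subsets of W and the y_i
   are values of e o f there: where some b_i is 1 the result depends on bump
   functions only, where f was smooth it remains so, and if the supports are small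
   enough then the values stay in any prescribed neighbourhood of the graph of f.
   Working through an exhaustion of M by compact sets, which exists because M is
   connected, paracompact and locally compact, the modifications are eventually
   constant near each point.  Since they may be confined to any open set
   containing the part to be smoothed, this applies to f(t, x) = f(x), changed for
   t > 0 only, and to a homotopy that has been made stationary near t = 0 and
   t = 1, where it is already smooth.

   The maps into N take values in arbitrary locally convex spaces, so that the
   chain rule is needed in this generality.  It rests on a mean value theorem for
   convex sets and is iterated by means of the differential df(x, v). *)

Require Import Defs.
From HB Require Import structures.
From mathcomp Require Import all_boot all_order all_algebra.
From mathcomp Require Import all_classical all_reals all_analysis.
From mathcomp Require Import ring lra.
Import Order.TTheory GRing.Theory Num.Theory.
Import numFieldNormedType.Exports.

Set Implicit Arguments.
Unset Strict Implicit.
Unset Printing Implicit Defensive.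

Local Open Scope classical_set_scope.
Local Open Scope ring_scope.

(** * Mean value theorem and strict derivatives *)

(** The definitions speak of iterated directional limits, while compositions are handled by [Cr].
    Passing from the former to the latter is the analytic obstacle: (x, v) |-> df(x, v) must again
    have all iterated derivatives, with continuous extensions to the boundary. They are sums of
    derivatives of f once df(x, v) is known to be linear in v; this linearity is not part of the
    definition and is derived from strict differentiability. On the geometric side, N is not assumed
    to carry a metric or a linear structure in which nearby maps could be compared. Closeness to the
    graph of f therefore serves to keep compact sets inside chart domains while the charts are
    treated one after another, and no homotopy is deduced from it: the smoothed map on the cylinder
    is itself the homotopy. In the first claim the smooth map is its slice at t = 1/2, an interior
    time, where slices inherit smoothness directly. *)

Definition cvx (R : numDomainType) (Y : lmodType R) (K : set Y) :=
  forall a b t, K a -> K b -> 0 <= t -> t <= 1 -> K (t *: a + (1 - t) *: b).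

(** The slope over [s, u] is the mean of the slopes over [s, t] and [t, u], weighted by the lengths
    of these intervals. *)
Lemma cvxT_ratio (R : realType) (Y : lmodType R) (c : R -> Y) (K : set Y)
  (s t u : R) : cvx K -> s < t -> t < u ->
  K ((t - s)^-1 *: (c t - c s)) -> K ((u - t)^-1 *: (c u - c t)) ->
  K ((u - s)^-1 *: (c u - c s)).
Proof.
move=> cK st tu K1 K2.
have su : s < u by exact: lt_trans tu.
have p1 : 0 < t - s by rewrite subr_gt0.
have p2 : 0 < u - t by rewrite subr_gt0.
have p3 : 0 < u - s by rewrite subr_gt0.
have := cK _ _ ((t - s) / (u - s)) K1 K2.
rewrite divr_ge0 ?(ltW p1) ?(ltW p3)// ler_pdivrMr// mul1r lerB// ?(ltW tu)//.
move=> /(_ isT isT); rewrite !scalerA.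
rewrite mulrAC divff ?gt_eqF// mul1r.
have -> : (1 - (t - s) / (u - s)) * (u - t)^-1 = (u - s)^-1.
  by field; rewrite !gt_eqF.
rewrite -scalerDr; congr (K (_ *: _)).
by rewrite addrC addrA subrK.
Qed.

(* The set of t whose mean slope on [0, t] lies in K contains its supremum, and
   can be continued beyond it. *)
Lemma mean_value_cvx (R : realType) (Y : lmodType R) (c : R -> Y) (K : set Y) :
  cvx K ->
  (forall s : R, 0 <= s -> s <= 1 ->
    \forall h \near 0^', K (h^-1 *: (c (s + h) - c s))) ->
  K (c 1 - c 0).
Proof.
move=> cK hK.
pose P t := t = 0 \/ K ((t - 0)^-1 *: (c t - c 0)).
pose S := [set t : R | [/\ 0 <= t, t <= 1 & P t]].
have S0 : S 0 by split=> //; left.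
have hS : has_sup S by split; [exists 0|exists 1 => t []].
have step (t u : R) : 0 <= t -> t < u -> P t -> K ((u - t)^-1 *: (c u - c t)) -> P u.
  move=> t0 tu [->|Pt] Ku; first by right.
  have [t00|tn0] := eqVneq t 0; first by right; rewrite -t00.
  by right; apply: (cvxT_ratio cK _ tu Pt Ku); rewrite lt_neqAle eq_sym tn0.
have [tau0 tau1] : 0 <= sup S /\ sup S <= 1.
  split; first exact: ub_le_sup hS.2 _ S0.
  by apply: ge_sup => [|t []//]; exists 0.
have := hK _ tau0 tau1; set tau := sup S => hn.
have [d /= d0 hd] : exists2 d : R, 0 < d & forall h, `|h| < d -> h != 0 ->
    K (h^-1 *: (c (tau + h) - c tau)).
  case: hn => d /= d0 hd; exists d => // h hh h0; apply: hd => //=.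
  by rewrite sub0r normrN.
have Ptau : P tau.
  have [t St tt] := sup_adherent d0 hS; rewrite -/tau in tt.
  have [tle t0 Pt] : [/\ t <= tau, 0 <= t & P t].
    by split; [exact: ub_le_sup hS.2 _ St|case: St..].
  have [<-//|tn] := eqVneq t tau.
  have tlt : t < tau by rewrite lt_neqAle tn.
  apply: (step t) => //.
  have := hd (t - tau); rewrite subr_eq0 => /(_ _ tn).
  rewrite (addrC tau) subrK -(opprB tau t) -(opprB (c tau) (c t)).
  rewrite invrN scaleNr scalerN opprK normrN gtr0_norm ?subr_gt0//.
  by apply; rewrite ltrBlDl -ltrBlDr.
have [tau_1|tau_n1] := eqVneq tau 1.
  move: Ptau; rewrite tau_1 => -[/eqP|]; first by rewrite oner_eq0.
  by rewrite subr0 invr1 scale1r.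
have tau_lt : tau < 1 by rewrite lt_neqAle tau_n1.
pose h := Num.min (d / 2) (1 - tau).
have h0 : 0 < h by rewrite lt_min divr_gt0// subr_gt0.
have Su : S (tau + h).
  split; first by rewrite addr_ge0// ltW.
    by rewrite -lerBrDl ge_min lexx orbT.
  apply: (step tau) => //; first by rewrite ltrDl.
  rewrite addrAC subrr add0r; apply: hd; last by rewrite gt_eqF.
  rewrite gtr0_norm// gt_min; apply/orP; left.
  by rewrite ltr_pdivrMr// ltr_pMr// ltr1n.
have := ub_le_sup hS.2 Su; rewrite -/tau gerDl => /le_lt_trans/(_ h0).
by rewrite ltxx.
Qed.

(** * Continuity on subsets, and limits in topological vector spaces *)

Section within.
Context {X Y Z : topologicalType}.
Implicit Types (A : set X) (B : set Y).

Lemma within_comp A B (f : X -> Y) (g : Y -> Z) :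
  {within A, continuous f} -> {within B, continuous g} ->
  (forall x, A x -> B (f x)) -> {within A, continuous (g \o f)}.
Proof.
move=> /subspace_continuousP cf /subspace_continuousP cg AB.
apply/subspace_continuousP => x Ax.
apply: (@cvg_comp _ _ _ f g _ (within B (nbhs (f x))) (nbhs (g (f x)))) _.
  move=> P /= PB; rewrite nbhs_filterE.
  have := cf x Ax _ PB; rewrite /= !nbhs_filterE /within /=.
  by apply: filterS => y BP Ay; apply: BP => //; exact: AB.
exact: cg (AB _ Ax).
Qed.

Lemma within_pair A (f : X -> Y) (g : X -> Z) :
  {within A, continuous f} -> {within A, continuous g} ->
  {within A, continuous (fun x => (f x, g x))}.
Proof.
move=> /subspace_continuousP cf /subspace_continuousP cg.
apply/subspace_continuousP => x Ax.
by apply: cvg_pair; [exact: cf|exact: cg].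
Qed.

Lemma within_eq A (f g : X -> Y) : (forall x, A x -> f x = g x) ->
  {within A, continuous f} -> {within A, continuous g}.
Proof.
by move=> fg; apply: subspace_eq_continuous => x /set_mem Ax; exact: fg.
Qed.

Lemma within_at A (f : X -> Y) x :
  open A -> A x -> {within A, continuous f} -> f y @[y --> x] --> f x.
Proof.
by move=> oA Ax; rewrite continuous_open_subspace// => /(_ x (mem_set Ax)).
Qed.

Lemma within_local A (f : X -> Y) :
  (forall x, A x -> exists2 O, nbhs x O & {within A `&` O, continuous f}) ->
  {within A, continuous f}.
Proof.
move=> loc; apply/subspace_continuousP => x Ax.
have [U nU /subspace_continuousP cf] := loc x Ax.
move=> P Px; have := cf x (conj Ax (nbhs_singleton nU)) P Px.
rewrite /= !nbhs_filterE /within /=; move: nU; apply: filterS2 => y Uy AP Ay.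
exact: AP.
Qed.

Lemma interior_setXT (A : set X) : (A `*` [set: Y])° = A° `*` [set: Y].
Proof.
apply/seteqP; split=> [[x y] [[P Q] /= [Px Qy] PQ]|[x y] /= [Ax _]].
  split=> //=; rewrite /interior /=; apply: filterS Px => z Pz.
  by have [] := PQ (z, y) (conj Pz (nbhs_singleton Qy)).
by exists (A, setT) => //=; split=> //; exact: filterT.
Qed.

End within.

Lemma continuous_pair (X Y Z : topologicalType) (f : X -> Y) (g : X -> Z) :
  continuous f -> continuous g -> continuous (fun x => (f x, g x)).
Proof. by move=> cf cg x; apply: cvg_pair; [exact: cf|exact: cg]. Qed.

Lemma continuous_compose (X Y Z : topologicalType) (f : X -> Y) (g : Y -> Z) :
  continuous f -> continuous g -> continuous (fun x => g (f x)).
Proof. by move=> cf cg x; apply: continuous_comp; [exact: cf|exact: cg]. Qed.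

Lemma continuous_fst (X Y : topologicalType) : continuous (@fst X Y).
Proof. by move=> p; exact: cvg_fst. Qed.

Lemma continuous_snd (X Y : topologicalType) : continuous (@snd X Y).
Proof. by move=> p; exact: cvg_snd. Qed.

Section tvs_limits.
Context {R : realType} {E : tvsType R}.

Lemma tvs_cvgD (T : Type) (F : set_system T) {FF : Filter F} (f g : T -> E) (a b : E) :
  f x @[x --> F] --> a -> g x @[x --> F] --> b -> f x + g x @[x --> F] --> a + b.
Proof.
move=> fa gb.
exact: (@cvg_comp _ _ _ (fun x => (f x, g x)) _ _ _ _ (cvg_pair fa gb)
  (@add_continuous E (a, b))).
Qed.

Lemma tvs_cvgZ (T : Type) (F : set_system T) {FF : Filter F} (k : T -> R) (f : T -> E)
  (r : R) (a : E) :
  k x @[x --> F] --> r -> f x @[x --> F] --> a ->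
  k x *: f x @[x --> F] --> r *: a.
Proof.
move=> kr fa.
exact: (@cvg_comp _ _ _ (fun x => (k x : R^o, f x)) _ _ _ _ (cvg_pair kr fa)
  (@scale_continuous R E (r, a))).
Qed.

Lemma tvs_cvgN (T : Type) (F : set_system T) {FF : Filter F} (f : T -> E) (a : E) :
  f x @[x --> F] --> a -> - f x @[x --> F] --> - a.
Proof.
by move=> fa; exact: (@cvg_comp _ _ _ f _ _ _ _ fa (@opp_continuous E a)).
Qed.

Lemma nbhs_cvx (y : E) (K : set E) : nbhs y K ->
  exists C, [/\ cvx C, open C, C y & C `<=` K].
Proof.
have [B cB [oB bB]] := @locally_convex R E.
move=> /bB [C [BC Cy] CK]; exists C; split=> //; last exact: oB.
move=> a b t Ca Cb t0 t1.
have := cB C (mem_set BC) a b (Itv01 t0 t1) (mem_set Ca) (mem_set Cb).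
by rewrite inE.
Qed.

End tvs_limits.

Lemma dnbhs0_mulr (R : realType) (c : R) : c != 0 ->
  (k * c) @[k --> (0 : R)^'] --> (0 : R)^'.
Proof.
move=> c0 Q [e /= e0 eQ]; exists (e / `|c|) => /=; first by rewrite divr_gt0 ?normr_gt0.
move=> r /=; rewrite sub0r normrN ltr_pdivlMr ?normr_gt0// -normrM => re r0.
by apply: eQ => /=; rewrite ?sub0r ?normrN// mulf_neq0.
Qed.

Section strict_derivative.
Context {R : realType} {X Y : tvsType R}.

(** Along the segment from y h to y h + h q h the directional derivative stays in a convex
    neighbourhood of g (x, v), so [mean_value_cvx] puts the quotient there. The moving point is for
    the additivity of the differential, the moving direction for the chain rule. *)
Lemma strict_derivative (V : set X) (f : X -> Y) (g : X * X -> Y) x v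
    (y q : R -> X) :
  open V -> V x ->
  (forall z w, V z -> diff_quotient f z w h @[h --> 0^'] --> g (z, w)) ->
  g z @[z --> (x, v)] --> g (x, v) ->
  y h @[h --> 0^'] --> x -> q h @[h --> 0^'] --> v ->
  diff_quotient f (y h) (q h) h @[h --> 0^'] --> g (x, v).
Proof.
move=> oV Vx fg cg yx qv P /nbhs_cvx[K [cK oK Kg KP]].
have good : \forall z \near (x, v), V z.1 /\ K (g z).
  near=> z; split.
    by near: z; exists (V, setT) => [|[] ? ? []//]; split=> /=; [exact:
      open_nbhs_nbhs|exact: filterT].
  by near: z; apply: cg; exact: open_nbhs_nbhs.
(* The second variable is independent of h; substituting s * h for it, with 0 <= s <= 1, controls
   the whole segment uniformly in s. *)
pose G (hr : R * R) := (y hr.1 + hr.2 *: q hr.1, q hr.1).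
have cG : G hr @[hr --> filter_prod 0^' (nbhs (0:R))] --> (x, v).
  apply: cvg_pair; last exact: cvg_comp cvg_fst qv.
  rewrite -[x]addr0 -(scale0r v); apply: tvs_cvgD; first exact: cvg_comp cvg_fst yx.
  by apply: tvs_cvgZ; [exact: cvg_snd|exact: cvg_comp cvg_fst qv].
have [[A B] /= [A0 B0] AB] := cG _ good.
have [d /= d0 dB] := B0.
suff : \forall h \near 0^', P (diff_quotient f (y h) (q h) h) by [].
near=> h; apply: KP.
have h0 : h != 0 by near: h; exact: nbhs_dnbhs_neq.
have inA : A h by near: h.
have hd : `|h| < d by near: h; exact: dnbhs0_lt.
have seg s : 0 <= s -> s <= 1 -> V (y h + (s * h) *: q h) /\ K (g (y h + (s * h) *: q h,
  q h)).
  move=> s0 s1; apply: (AB (h, s * h)); split=> //=; apply: dB => /=.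
  rewrite sub0r normrN normrM ger0_norm//; apply: le_lt_trans hd.
  by rewrite ler_piMl.
(* A slope of [c] with increment r is a quotient of f with step r * h, and so tends to a value of g
   in K. *)
pose c (s : R) := h^-1 *: f (y h + (s * h) *: q h).
have : K (c 1 - c 0).
  apply: mean_value_cvx => // s s0 s1.
  have [Vs Ks] := seg s s0 s1.
  have sh := dnbhs0_mulr h0.
  have /(_ K) := cvg_comp _ _ sh (fg _ (q h) Vs).
  rewrite !nbhs_filterE => /(_ (open_nbhs_nbhs (conj oK Ks))) /=.
  apply: filterS => r /=; rewrite /diff_quotient /c -scalerBr scalerA.
  by rewrite invfM mulrDl scalerDl addrA [r^-1 * _]mulrC.
by rewrite /c /diff_quotient mul1r mul0r scale0r addr0 -scalerBr.
Unshelve. all: by end_near. Qed.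

End strict_derivative.

(** * Differential calculus on sets with dense interior *)

(* C^n on [A], by means of the differential as a map on [X * X], continuously
   extended from the interior to [A].  With this definition the chain rule
   d(g o f)(x, v) = dg(f x, df(x, v)) is propagated to all orders by a plain
   induction, which is not so for [Cn_on]. *)
Fixpoint Cr (R : realType) (n : nat) : forall X Y : tvsType R, set X -> (X -> Y) -> Prop
  :=
  match n with
  | 0 => fun X Y A f => {within A, continuous f}
  | n'.+1 => fun X Y A f => {within A, continuous f} /\
      exists g : X * X -> Y,
        (forall x v, A° x -> diff_quotient f x v h @[h --> 0^'] --> g (x, v)) /\
        Cr n' (A `*` setT) g
  end.

Section Cr_theory.
Context {R : realType}.
Implicit Types (X Y Z E : tvsType R) (n : nat).

Lemma Cr_continuous n X Y (A : set X) (f : X -> Y) :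
  Cr n A f -> {within A, continuous f}.
Proof. by case: n => //= n []. Qed.

Lemma Cr_pred n X Y (A : set X) (f : X -> Y) : Cr n.+1 A f -> Cr n A f.
Proof.
elim: n X Y A f => [|n IH] X Y A f [cf [g [fg Cg]]] //.
by split=> //; exists g; split=> //; exact: IH.
Qed.

Lemma Cr_sub n X Y (A B : set X) (f : X -> Y) : B `<=` A -> Cr n A f -> Cr n B f.
Proof.
elim: n X Y A B f => [|n IH] X Y A B f BA /=; first exact: continuous_subspaceW.
move=> [cf [g [fg Cg]]]; split; first exact: continuous_subspaceW cf.
exists g; split=> [x v Bx|]; first exact: fg (interiorS BA Bx).
by apply: IH Cg => -[x v] [Bx _]; split=> //; exact: BA.
Qed.

Lemma near_line X (A : set X) (x v : X) :
  A° x -> \forall h \near (0 : R)^', A (x + h *: v).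
Proof.
move=> Ax; apply: nbhs_dnbhs.
have : x + h *: v @[h --> (0 : R)] --> x + 0 *: v.
  by apply: tvs_cvgD; [exact: cvg_cst|apply: tvs_cvgZ; [exact: cvg_id|exact: cvg_cst]].
by rewrite scale0r addr0 => /(_ _ Ax).
Qed.

Lemma diff_quotient_eq X Y (A : set X) (f g : X -> Y) (x v : X) (l : Y) :
  (forall y, A y -> f y = g y) -> A° x ->
  diff_quotient f x v h @[h --> 0^'] --> l ->
  diff_quotient g x v h @[h --> 0^'] --> l.
Proof.
move=> fg Ax; apply: cvg_trans; apply: near_eq_cvg.
have /= := near_line v Ax; apply: filterS => h Ah.
by rewrite /diff_quotient !fg//; exact: interior_subset.
Qed.

Lemma Cr_eq n X Y (A : set X) (f g : X -> Y) :
  (forall x, A x -> f x = g x) -> Cr n A f -> Cr n A g.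
Proof.
case: n => [|n] fg /=; first exact: within_eq.
move=> [cf [df [fdf Cdf]]]; split; first exact: within_eq cf.
by exists df; split=> // x v Ax; exact: diff_quotient_eq fg Ax (fdf x v Ax).
Qed.

Lemma affine_linear_part X Y (phi L : X -> Y) :
  (forall y w (h : R), phi (y + h *: w) = phi y + h *: L w) ->
  forall v w (h : R), L (v + h *: w) = L v + h *: L w.
Proof.
move=> phiL v w h.
have := phiL (0 + 1 *: v) w h; rewrite -addrA phiL scale1r.
have := phiL 0 (v + h *: w) 1; rewrite !scale1r => ->.
by rewrite -!addrA => /addrI.
Qed.

(** Complements [Cr_comp], whose outer map lives on an open set: here the domain of f may have
    boundary points, at the price that phi takes interior points to interior points. The
    differential is that of f after the affine map phi x L, whose linear part is L x L. *)
Lemma Cr_precomp_affine n X X' Y (A : set X) (B : set X') (f : X -> Y)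
    (phi L : X' -> X) :
  continuous phi -> continuous L ->
  (forall y w (h : R), phi (y + h *: w) = phi y + h *: L w) ->
  (forall y, B y -> A (phi y)) -> (forall y, B° y -> A° (phi y)) ->
  Cr n A f -> Cr n B (f \o phi).
Proof.
elim: n X X' Y A B f phi L => [|n IH] X X' Y A B f phi L cphi cL phiL BA BA0 /=.
  by move=> cf; apply: within_comp cf BA; exact: continuous_subspaceT.
move=> [cf [g [fg Cg]]]; split.
  by apply: within_comp cf BA; exact: continuous_subspaceT.
exists (g \o (fun p => (phi p.1, L p.2))); split.
  move=> y w By; have := fg _ (L w) (BA0 _ By); apply: cvg_trans.
  by apply: near_eq_cvg; apply: nearW => h; rewrite /diff_quotient /= phiL.
have LL := affine_linear_part phiL.
apply: (IH _ _ _ _ _ _ _ (fun p => (L p.1, L p.2))) Cg.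
- exact: continuous_pair (continuous_compose (@continuous_fst _ _) cphi)
  (continuous_compose (@continuous_snd _ _) cL).
- exact: continuous_pair (continuous_compose (@continuous_fst _ _) cL)
  (continuous_compose (@continuous_snd _ _) cL).
- by move=> p q h /=; rewrite phiL LL.
- by move=> p [Bp _]; split=> //; exact: BA.
- by move=> p; rewrite !interior_setXT => -[Bp _]; split=> //; exact: BA0.
Qed.

(** The differential (x, v) |-> L v is its own linear part, so the induction hypothesis covers
    it. *)
Lemma Cr_affine n X Y (A : set X) (phi L : X -> Y) :
  continuous phi -> continuous L ->
  (forall y w (h : R), phi (y + h *: w) = phi y + h *: L w) -> Cr n A phi.
Proof.
elim: n X Y A phi L => [|n IH] X Y A phi L cphi cL phiL /=.
  exact: continuous_subspaceT.
split; first exact: continuous_subspaceT.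
exists (L \o snd); split.
  move=> x v _; apply: (@cvg_trans _ (L v @[h --> (0 : R)^'])); last exact: cvg_cst.
  apply: near_eq_cvg; near=> h.
  rewrite /diff_quotient phiL addrAC subrr add0r scalerA mulVf ?scale1r//.
  by near: h; exact: nbhs_dnbhs_neq.
have LL := affine_linear_part phiL.
apply: (IH _ _ _ _ (L \o snd)).
- exact: continuous_compose (@continuous_snd _ _) cL.
- exact: continuous_compose (@continuous_snd _ _) cL.
- by move=> p q h /=; rewrite LL.
Unshelve. all: by end_near. Qed.

Lemma Cr_cst n X Y (A : set X) (y : Y) : Cr n A (fun _ => y).
Proof.
apply: (@Cr_affine _ _ _ _ _ (fun _ => 0)).
- by move=> x; exact: cvg_cst.
- by move=> x; exact: cvg_cst.
- by move=> *; rewrite scaler0 addr0.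
Qed.

Lemma Cr_pair n X Y Z (A : set X) (f : X -> Y) (g : X -> Z) :
  Cr n A f -> Cr n A g -> Cr n A (fun x => (f x, g x) : (Y * Z)%type).
Proof.
elim: n X Y Z A f g => [|n IH] X Y Z A f g /=; first exact: within_pair.
move=> [cf [df [fdf Cdf]]] [cg [dg [gdg Cdg]]]; split; first exact: within_pair.
exists (fun p => (df p, dg p)); split; last exact: IH.
move=> x v Ax; exact: cvg_pair (fdf x v Ax) (gdg x v Ax).
Qed.

Lemma Cr_add n X Y (A : set X) (f g : X -> Y) :
  Cr n A f -> Cr n A g -> Cr n A (fun x => f x + g x).
Proof.
elim: n X Y A f g => [|n IH] X Y A f g /=.
  move=> cf cg x; exact: tvs_cvgD (cf x) (cg x).
move=> [cf [df [fdf Cdf]]] [cg [dg [gdg Cdg]]]; split.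
  by move=> x; exact: tvs_cvgD (cf x) (cg x).
exists (fun p => df p + dg p); split; last exact: IH.
move=> x v Ax; apply: cvg_trans (tvs_cvgD (fdf x v Ax) (gdg x v Ax)).
apply: near_eq_cvg; apply: nearW => h.
by rewrite /diff_quotient -scalerDr opprD addrACA.
Qed.

Lemma Cr_comp n X Y Z (A : set X) (V : set Y) (f : X -> Y) (g : Y -> Z) :
  open V -> (forall x, A x -> V (f x)) ->
  Cr n V g -> Cr n A f -> Cr n A (g \o f).
Proof.
elim: n X Y Z A V f g => [|n IH] X Y Z A V f g oV AV /=.
  by move=> cg cf; exact: within_comp cf cg AV.
move=> [cg [dg [gdg Cdg]]] Cf; have [cf [df [fdf Cdf]]] := Cf.
split; first exact: within_comp cf cg AV.
have oVT : open (V `*` [set: Y]).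
  rewrite openE => p Vp; rewrite interior_setXT; split=> //.
  by apply: open_nbhs_nbhs; case: Vp.
exists (dg \o (fun p => (f p.1, df p))); split.
  move=> x v Ax; have Vx := AV _ (interior_subset Ax).
  have fx : f x @[h --> (0 : R)^'] --> f x by exact: cvg_cst.
  have Vp : (V `*` [set: Y]) (f x, df (x, v)) by split.
  (* The increment of f is h times its quotient, so the quotient of g \o f is the one of g at the
     fixed point f x in the moving direction [diff_quotient f x v h]. *)
  have /= := strict_derivative oV Vx (fun z w Vz => gdg z w (open_nbhs_nbhs (conj oV
    Vz))) (within_at oVT Vp (Cr_continuous Cdg)) fx (fdf x v Ax).
  apply: cvg_trans; apply: near_eq_cvg; near=> h.
  rewrite /diff_quotient scalerA divff ?scale1r ?[f x + _]addrC ?subrK//.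
  by near: h; exact: nbhs_dnbhs_neq.
apply: IH oVT _ Cdg _; first by move=> -[x v] [Ax _]; split=> //; exact: AV.
apply: Cr_pair => //; apply: (@Cr_precomp_affine _ _ _ _ A _ f fst fst) => //.
- exact: continuous_fst.
- exact: continuous_fst.
- by move=> p [].
- by move=> p; rewrite interior_setXT => -[].
- exact: Cr_pred Cf.
Unshelve. all: by end_near. Qed.

Lemma bilin_incr E (k l h : R) (z w : E) :
  (k + h * l) *: (z + h *: w) - k *: z =
  h *: (k *: w + l *: z + h *: (l *: w)).
Proof.
rewrite scalerDl !scalerDr [k *: z + _]addrC -!addrA (addrC (k *: z)) -!addrA.
by rewrite addNr addr0 !scalerA [k * h]mulrC (mulrAC h l h).
Qed.

(** The differential at (k, z) in direction (l, w) is k w + l z, a sum of two copies of the same map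
    after linear projections; the induction thus feeds on itself. On the whole space the interior
    condition of [Cr_precomp_affine] is trivial. *)
Lemma Cr_scale_fun n E (A : set (R^o * E)%type) : Cr n A (fun p => p.1 *: p.2).
Proof.
apply: (@Cr_sub _ _ _ setT) => //.
elim: n => [|n IH] /=.
  by apply: continuous_subspaceT; exact: scale_continuous.
split; first by apply: continuous_subspaceT; exact: scale_continuous.
exists (fun q => q.1.1 *: q.2.2 + q.2.1 *: q.1.2); split.
  move=> [k z] [l w] _ /=.
  apply: (@cvg_trans _ (k *: w + l *: z + h *: (l *: w) @[h --> (0 : R)^'])).
    apply: near_eq_cvg; near=> h.
    have h0 : h != 0 by near: h; exact: nbhs_dnbhs_neq.
    have -> : diff_quotient (fun p : R^o * E => p.1 *: p.2) (k, z) (l, w) h =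
        h^-1 *: ((k + h * l) *: (z + h *: w) - k *: z) by [].
    by rewrite bilin_incr [RHS]scalerA mulVf// scale1r.
  rewrite -[in X in _ `=>` X](addr0 (k *: w + l *: z)).
  apply: tvs_cvgD; first exact: cvg_cst.
  rewrite -(scale0r (l *: w)); apply: tvs_cvgZ; last exact: cvg_cst.
  exact: nbhs_dnbhs.
apply: Cr_add.
  apply: (@Cr_precomp_affine _ _ _ _ setT _ _ (fun q => (q.1.1, q.2.2) : R^o * E)
    (fun q => (q.1.1, q.2.2) : R^o * E) _ _ _ _ _ IH) => //.
  - exact: continuous_pair (continuous_compose (@continuous_fst _ _) (@continuous_fst _
    _)) (continuous_compose (@continuous_snd _ _) (@continuous_snd _ _)).
  - exact: continuous_pair (continuous_compose (@continuous_fst _ _) (@continuous_fst _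
    _)) (continuous_compose (@continuous_snd _ _) (@continuous_snd _ _)).
  - by move=> q _; rewrite interiorT.
apply: (@Cr_precomp_affine _ _ _ _ setT _ _ (fun q => (q.2.1, q.1.2) : R^o * E)
    (fun q => (q.2.1, q.1.2) : R^o * E) _ _ _ _ _ IH) => //.
- exact: continuous_pair (continuous_compose (@continuous_snd _ _) (@continuous_fst _
  _)) (continuous_compose (@continuous_fst _ _) (@continuous_snd _ _)).
- exact: continuous_pair (continuous_compose (@continuous_snd _ _) (@continuous_fst _
  _)) (continuous_compose (@continuous_fst _ _) (@continuous_snd _ _)).
- by move=> q _; rewrite interiorT.
Unshelve. all: by end_near. Qed.

Lemma Cr_scale n X E (A : set X) (k : X -> R^o) (f : X -> E) :
  Cr n A k -> Cr n A f -> Cr n A (fun x => k x *: f x).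
Proof.
move=> Ck Cf; apply: (@Cr_comp _ _ _ _ _ setT (fun x => (k x, f x) : R^o * E) (fun p =>
  p.1 *: p.2)) => //.
- exact: openT.
- exact: Cr_scale_fun.
- exact: Cr_pair.
Qed.

End Cr_theory.

(** The differentials found locally agree at boundary points too: each one is there the limit of the
    derivative along the interior, which is dense, and limits in Y are unique. *)
Lemma Cr_local (R : realType) n (X Y : tvsType R) (A : set X) (f : X -> Y) :
  hausdorff_space Y -> A `<=` closure A° ->
  (forall x, A x -> exists2 U, nbhs x U & Cr n (A `&` U) f) -> Cr n A f.
Proof.
move=> hY; elim: n X A f => [|n IH] X A f dA loc; first exact: within_local.
split.
  by apply: within_local => x /loc[U nU [cU _]]; exists U.
have loc' x : exists Ug : set X * (X * X -> Y), A x ->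
    [/\ nbhs x Ug.1,
        forall z v, (A `&` Ug.1)° z -> diff_quotient f z v h @[h --> 0^'] --> Ug.2 (z,
          v) &
        Cr n ((A `&` Ug.1) `*` setT) Ug.2].
  have [Ax|nAx] := pselect (A x); last by exists (setT, fun _ => 0).
  by have [U nU [_ [g [fg Cg]]]] := loc x Ax; exists (U, g).
have [Ug hU] := choice loc'.
have uniq x z v : A x -> A z -> (Ug x).1 z -> nbhs z (Ug x).1 ->
    (Ug z).2 (z, v) = (Ug x).2 (z, v).
  move=> Ax Az Uxz nz.
  have [_ fx Cx] := hU x Ax; have [nz' fz Cz] := hU z Az.
  pose F := within A° (nbhs z).
  have FF : ProperFilter F.
    by apply: within_nbhs_proper; exact: dA.
  have lim y : (Ug y).1 z -> nbhs z (Ug y).1 -> Cr n ((A `&` (Ug y).1) `*` setT) (Ug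
    y).2 ->
      (Ug y).2 (w, v) @[w --> F] --> (Ug y).2 (z, v).
    move=> Uyz nyz /Cr_continuous/subspace_continuousP/(_ (z, v) (conj (conj Az Uyz)
      Logic.I)) c.
    move=> Q /c; rewrite /F /= !nbhs_filterE /within /= => -[[B1 B2] /= [B1z B2v] BQ].
    move: nyz; apply: filterS2 B1z => w B1w Uw Aw.
    apply: (BQ (w, v)) => /=; first by split=> //; exact: nbhs_singleton.
    by split=> //; split=> //; exact: interior_subset.
  have lx := lim x Uxz nz Cx.
  have lz := lim z (nbhs_singleton nz') nz' Cz.
  apply: (cvg_unique hY lz); apply: cvg_trans lx; apply: near_eq_cvg.
  rewrite /F /= near_withinE.
  have {}nz' := nbhs_interior nz'; have {}nz := nbhs_interior nz.
  near=> w => Aw.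
  have xw : (A `&` (Ug x).1)° w by rewrite interiorI; split=> //; near: w.
  have zw : (A `&` (Ug z).1)° w by rewrite interiorI; split=> //; near: w.
  exact: (cvg_unique hY (fx w v xw) (fz w v zw)).
(* Each point uses the differential chosen for itself. Near x, [uniq] replaces it by the one chosen
   for x, after shrinking to the interior of the neighbourhood of x. *)
exists (fun p => (Ug p.1).2 p); split.
  move=> x v Ax0; have Ax := interior_subset Ax0; have [nx fx _] := hU x Ax.
  by apply: fx; rewrite interiorI.
apply: IH.
  move=> [x v] [Ax _] Q [[Q1 Q2] /= [Q1x Q2v] QQ].
  have [z [Az Q1z]] := dA x Ax Q1 Q1x; exists (z, v); split.
    by rewrite interior_setXT.
  by apply: QQ; split=> //; exact: nbhs_singleton.
move=> [x v] [Ax _]; have [nx _ Cx] := hU x Ax.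
exists ((Ug x).1° `*` setT).
  exists ((Ug x).1°, setT) => //=; split; last exact: filterT.
  exact: nbhs_interior.
apply: (@Cr_eq _ _ _ _ _ (Ug x).2).
  move=> [z w] /= [[Az _] [Uz _]]; apply/esym/uniq => //.
  exact: interior_subset.
by apply: Cr_sub Cx => -[z w] [[Az _] [/interior_subset Uz _]].
Unshelve. all: by end_near. Qed.

(** * Equivalence with the iterated directional derivatives *)

Lemma nth_enum_map (T : Type) (a0 : T) (l : seq T) :
  [seq nth a0 l (i : 'I_(size l)) | i <- enum 'I_(size l)] = l.
Proof.
apply: (@eq_from_nth _ a0); first by rewrite size_map size_enum_ord.
move=> i; rewrite size_map size_enum_ord => il.
by rewrite (nth_map (Ordinal il)) ?size_enum_ord// nth_enum_ord.
Qed.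

Section iterated.
Context {R : realType} {X Y : tvsType R} (hY : hausdorff_space Y).
Implicit Types (f g : X -> Y) (A U V : set X) (l : seq X).

Lemma lim0E (g : R -> Y) (y : Y) : g h @[h --> 0^'] --> y -> lim0 g = y.
Proof.
move=> gy; have /= := @xgetPex _ 0 [set y | g h @[h --> 0^'] --> y].
by move=> /(_ (ex_intro _ y gy)) gl; exact: (cvg_unique hY gl gy).
Qed.

Definition ddir f (v : X) : X -> Y := fun x => lim0 (diff_quotient f x v).

Definition iter_ddir f l : X -> Y := foldl ddir f l.

Lemma iter_ddir_rcons f l v : iter_ddir f (rcons l v) = ddir (iter_ddir f l) v.
Proof. by rewrite /iter_ddir foldl_rcons. Qed.

Lemma ndiffE f n x (v : 'I_n -> X) :
  ndiff f x v = iter_ddir f [seq v i | i <- enum 'I_n] x.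
Proof.
elim: n x v => [|n IH] x v /=; first by rewrite enum_ord0.
rewrite enum_ordSr map_rcons iter_ddir_rcons -map_comp /ddir.
by congr (lim0 (diff_quotient _ _ _)); apply/funext => y; exact: IH.
Qed.

Lemma diff_quotient_near A f g (x v : X) : (forall y, A y -> f y = g y) -> A° x ->
  \forall h \near 0^', diff_quotient f x v h = diff_quotient g x v h.
Proof.
move=> fg Ax; have := near_line v Ax; apply: filterS => h Ah.
by rewrite /diff_quotient !fg//; exact: interior_subset.
Qed.

Lemma lim0_near (a b : R -> Y) : (\forall h \near 0^', a h = b h) -> lim0 a = lim0 b.
Proof.
move=> ab; rewrite /lim0; congr xget; apply/seteqP; split=> y /=.
  by apply: cvg_trans; apply: near_eq_cvg; apply: filterS ab.
by apply: cvg_trans; apply: near_eq_cvg; apply: filterS ab.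
Qed.

Lemma iter_ddir_eq V f g l : open V -> (forall x, V x -> f x = g x) ->
  forall x, V x -> iter_ddir f l x = iter_ddir g l x.
Proof.
move=> oV; elim: l f g => [|v l IH] f g fg //=.
apply: IH => y Vy; apply: lim0_near; apply: (diff_quotient_near _ fg).
by apply: open_nbhs_nbhs.
Qed.

(* [smooth_dense_interior] with the directions gathered in a list, so that an
   iterated derivative can be unfolded from either end. *)
Definition iter_smooth A f :=
  [/\ {within A, continuous f},
      forall l v x, A° x ->
        exists y : Y, diff_quotient (iter_ddir f l) x v h @[h --> 0^'] --> y &
      forall k, exists2 g : X * {ptws 'I_k -> X} -> Y,
        {within A `*` setT, continuous g} &
        forall p, A° p.1 -> g p = iter_ddir f [seq p.2 i | i <- enum 'I_k] p.1].

Lemma Cn_iter_exists A f l (v x : X) : (forall n, Cn_on n A° f) -> A° x ->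
  exists y : Y, diff_quotient (iter_ddir f l) x v h @[h --> 0^'] --> y.
Proof.
move=> sf Ax; have [_ /(_ (size l) (leqnn _)) [ex _]] := sf (size l).+1.
have [y hy] := ex x (fun i => nth 0 (rcons l v) i) Ax; exists y.
apply: cvg_trans hy; apply: near_eq_cvg; apply: nearW => h.
congr diff_quotient; last by rewrite nth_rcons ltnn eqxx.
apply/funext => z; rewrite ndiffE; congr iter_ddir.
rewrite -[RHS](nth_enum_map 0); apply: eq_map => i /=.
by rewrite nth_rcons ltn_ord.
Qed.

Lemma smooth_iter A f : smooth_dense_interior A f -> iter_smooth A f.
Proof.
move=> [cf sf ex]; split=> //; first by move=> l v x Ax; exact: Cn_iter_exists.
move=> k; have [g cg gE] := ex k; exists g => // p Ap.
by rewrite gE// /ndiff_uncurry ndiffE.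
Qed.

Lemma smooth_on_iter V f : open V -> smooth_on V f -> iter_smooth V f.
Proof.
move=> oV sf; have VV : V° = V by apply/seteqP; split; [exact: interior_subset|by move:
  oV; rewrite openE].
split; first by have [] := sf 0%N.
  by move=> l v x; apply: Cn_iter_exists; rewrite VV.
case=> [|k].
  exists (f \o fst) => [|p _] /=; last by rewrite enum_ord0.
  apply: (@within_comp _ _ _ _ V); [|by have [] := sf 0%N|by move=> p []].
  by apply: continuous_subspaceT; exact: continuous_fst.
exists (@ndiff_uncurry R X Y f k.+1); last by move=> p _; rewrite /ndiff_uncurry ndiffE.
by have [_ /(_ k (leqnn _)) []] := sf k.+1.
Qed.

Lemma iter_smooth_dense A f : iter_smooth A f -> smooth_dense_interior A f.
Proof.
move=> [cf ex ext]; split=> //; last first.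
  move=> k; have [g cg gE] := ext k; exists g => // p Ap.
  by rewrite gE// /ndiff_uncurry ndiffE.
move=> n; split; first by apply: continuous_subspaceW cf; exact: interior_subset.
move=> k _; split.
  move=> x v Ax; have [y hy] := ex [seq v (widen_ord (leqnSn k) i) | i <- enum 'I_k] (v
    ord_max) x Ax.
  exists y; apply: cvg_trans hy; apply: near_eq_cvg; apply: nearW => h.
  congr diff_quotient; apply/funext => z; by rewrite ndiffE.
have [g cg gE] := ext k.+1.
apply: (@within_eq _ _ _ g).
  by move=> p [Ap _]; rewrite gE// /ndiff_uncurry ndiffE.
by apply: continuous_subspaceW cg => p [Ap _]; split=> //; exact: interior_subset.
Qed.

End iterated.

Lemma ptws_continuous (R : realType) (P : topologicalType) (X : tvsType R) k
    (phi : 'I_k -> P -> X) :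
  (forall i, continuous (phi i)) ->
  continuous (fun p => (fun i => phi i p) : {ptws 'I_k -> X}).
Proof.
move=> cphi p; apply/cvg_sup => i; apply/cvg_image.
  by apply/seteqP; split=> // y _; exists (fun _ => y).
move=> Q /(cphi i p) Qp; exists (fun w : 'I_k -> X => Q (w i)).
  by [].
by apply/seteqP; split=> [y [w Qw <-]|y Qy] //; exists (fun _ => y).
Qed.

Lemma ptws_proj_continuous (R : realType) (X : tvsType R) k (i : 'I_k) :
  continuous (fun w : {ptws 'I_k -> X} => w i).
Proof. exact: (@proj_continuous _ (fun _ => X) i). Qed.

Lemma pair_line (R : realType) (X X' : tvsType R) (x w : X) (v u : X') (h : R) :
  (x, v) + h *: (w, u) = (x + h *: w, v + h *: u).
Proof. by []. Qed.

(** * From [Cr] to iterated directional derivatives *)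

Section Cr_to_iter.
Context {R : realType} {Y : tvsType R} (hY : hausdorff_space Y).

Lemma ddir_Cr (X : tvsType R) (A : set X) (f : X -> Y) (g : X * X -> Y) x v :
  (forall x v, A° x -> diff_quotient f x v h @[h --> 0^'] --> g (x, v)) ->
  A° x -> ddir f v x = g (x, v).
Proof. by move=> fg Ax; apply: lim0E => //; exact: fg. Qed.

Lemma iter_ddir_slice (X : tvsType R) (g : X * X -> Y) v l x :
  iter_ddir (fun y => g (y, v)) l x = iter_ddir g [seq (w, 0) | w <- l] (x, v).
Proof.
elim: l g x => [|w l IH] g x //=; rewrite -IH; congr iter_ddir.
apply/funext => y; congr lim0; apply/funext => h.
by rewrite /diff_quotient pair_line scaler0 addr0.
Qed.

(** The first direction becomes part of the base point and the others act on x alone. This matches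
    the recursion of [Cr], which differentiates df, with lists of directions unfolded from the
    front. *)
Lemma iter_ddir_cons_Cr (X : tvsType R) (A : set X) (f : X -> Y)
    (g : X * X -> Y) x v l :
  (forall x v, A° x -> diff_quotient f x v h @[h --> 0^'] --> g (x, v)) ->
  A° x -> iter_ddir f (v :: l) x = iter_ddir g [seq (w, 0) | w <- l] (x, v).
Proof.
move=> fg Ax; rewrite -iter_ddir_slice /=.
apply: (@iter_ddir_eq _ _ _ A°) => //; first exact: open_interior.
by move=> y Ay; exact: ddir_Cr fg Ay.
Qed.

Lemma Cr_iter_exists n (X : tvsType R) (A : set X) (f : X -> Y) l v x :
  size l = n -> Cr n.+1 A f -> A° x ->
  exists y : Y, diff_quotient (iter_ddir f l) x v h @[h --> 0^'] --> y.
Proof.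
elim: n X A f l v x => [|n IH] X A f [|u l] v x //= sl [_ [g [fg Cg]]] Ax.
  by exists (g (x, v)); exact: fg.
have sl' : size [seq (w, 0 : X) | w <- l] = n by rewrite size_map; case: sl.
have Axu : (A `*` [set: X])° (x, u) by rewrite interior_setXT.
have [y hy] := IH _ _ g _ (v, 0) (x, u) sl' Cg Axu.
exists y; apply: cvg_trans hy; apply: near_eq_cvg.
have := near_line v (nbhs_interior Ax); apply: filterS => h Ah.
rewrite /diff_quotient pair_line scaler0 addr0.
congr (_ *: (_ - _)); apply/esym; first exact: iter_ddir_cons_Cr fg Ah.
exact: iter_ddir_cons_Cr fg Ax.
Qed.

Lemma Cr_iter_extension n (X : tvsType R) (A : set X) (f : X -> Y) :
  Cr n A f -> exists2 g : X * {ptws 'I_n -> X} -> Y,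
    {within A `*` setT, continuous g} &
    forall p, A° p.1 -> g p = iter_ddir f [seq p.2 i | i <- enum 'I_n] p.1.
Proof.
elim: n X A f => [|n IH] X A f.
  move=> cf; exists (f \o fst) => [|p _] /=; last by rewrite enum_ord0.
  apply: (@within_comp _ _ _ _ A) cf _; last by move=> p [].
  by apply: continuous_subspaceT; exact: continuous_fst.
move=> [cf [g [fg Cg]]]; have [G cG GE] := IH _ _ _ Cg.
exists (fun p => G ((p.1, p.2 ord0), fun i => (p.2 (lift ord0 i), 0))).
  apply: (@within_comp _ _ _ _ _ _ G _ cG) => /=; last by move=> p [].
  apply: continuous_subspaceT; apply: continuous_pair.
    apply: continuous_pair; first exact: continuous_fst.
    exact: continuous_compose (@continuous_snd _ _) (@ptws_proj_continuous _ _ _ _).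
  apply: ptws_continuous => i; apply: continuous_pair.
    exact: continuous_compose (@continuous_snd _ _) (@ptws_proj_continuous _ _ _ _).
  by move=> p; exact: cvg_cst.
move=> [x w] /= Ax; rewrite GE /=; last by rewrite interior_setXT.
by rewrite enum_ordSl map_cons (iter_ddir_cons_Cr _ _ fg)// -!map_comp.
Qed.

Lemma Cr_iter_smooth (X : tvsType R) (A : set X) (f : X -> Y) :
  (forall n, Cr n A f) -> iter_smooth A f.
Proof.
move=> Cf; split; first exact: (Cf 0%N).
  by move=> l v x; apply: Cr_iter_exists.
by move=> k; exact: Cr_iter_extension.
Qed.

End Cr_to_iter.

(* The derivative in direction [(w, u)] of a map
   [(x, v) |-> sum_t d^(size t) f(x).t], the lists [t] being those of [st],
   where the first list has the form [v :: m] and the other ones do not depend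
   on [v]: the map being linear in [v], one gets again such a sum. *)
Definition dstep (T : Type) (st : seq T * seq (seq T)) (wu : T * T) :=
  (rcons st.1 wu.1, (wu.2 :: st.1) :: [seq rcons t wu.1 | t <- st.2]).

(** Evaluation of symbolic directions: [dstep] only rearranges directions, so the terms can be
    computed once with directions that are functions of a parameter, and evaluated afterwards. *)
Definition dmap (S T : Type) (e : S -> T) (st : seq S * seq (seq S)) :=
  (map e st.1, map (map e) st.2).

Lemma dmap_dstep (S T : Type) (e : S -> T) st ws :
  dmap e (foldl (@dstep S) st ws) =
  foldl (@dstep T) (dmap e st) [seq (e wu.1, e wu.2) | wu <- ws].
Proof.
elim: ws st => [|wu ws IH] st //=; rewrite IH; congr foldl.
rewrite /dmap /dstep /= map_rcons -!map_comp; congr (_, _ :: _).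
by apply: eq_map => t /=; rewrite map_rcons.
Qed.

(** * From iterated directional derivatives to [Cr] *)

Section iter_to_Cr.
Context {R : realType} {X Y : tvsType R} (hY : hausdorff_space Y).
Variables (A : set X) (f : X -> Y).
Hypothesis sf : iter_smooth A f.

Definition dsum (st : seq X * seq (seq X)) (p : X * X) : Y :=
  iter_ddir f (p.2 :: st.1) p.1 + foldr (fun t y => iter_ddir f t p.1 + y) 0 st.2.

Let ddirP l v x : A° x -> diff_quotient (iter_ddir f l) x v h @[h --> 0^'] -->
  iter_ddir f (rcons l v) x.
Proof.
move=> Ax; rewrite iter_ddir_rcons /ddir.
by have [_ ex _] := sf; have [y hy] := ex l v x Ax; rewrite (lim0E hY hy).
Qed.

Let line_cvg l x w : A° x ->
  iter_ddir f l (x + h *: w) @[h --> (0 : R)^'] --> iter_ddir f l x.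
Proof.
move=> Ax; have d := @ddirP l w x Ax.
rewrite -[in X in _ --> X](addr0 (iter_ddir f l x)).
rewrite -[in X in _ --> X](scale0r (iter_ddir f (rcons l w) x)).
apply: (@cvg_trans _ (iter_ddir f l x + h *: diff_quotient (iter_ddir f l) x w h @[h -->
  (0 : R)^'])).
  apply: near_eq_cvg; near=> h.
  rewrite /diff_quotient scalerA divff ?scale1r ?[iter_ddir f l x + _]addrC ?subrK//.
  by near: h; exact: nbhs_dnbhs_neq.
by apply: tvs_cvgD; [exact: cvg_cst|apply: tvs_cvgZ; [exact: nbhs_dnbhs|exact: d]].
Unshelve. all: by end_near. Qed.

Let ddir_ext : exists2 G : X * X -> Y, {within A `*` setT, continuous G} &
  forall p, A° p.1 -> G p = iter_ddir f [:: p.2] p.1.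
Proof.
have [_ _ /(_ 1%N) [g cg gE]] := sf.
exists (fun p => g (p.1, fun _ => p.2)).
  apply: (@within_comp _ _ _ _ _ _ g _ cg) => /=; last by move=> p [].
  apply: continuous_subspaceT; apply: continuous_pair; first exact: continuous_fst.
  by apply: ptws_continuous => i; exact: continuous_snd.
by move=> p Ap; rewrite gE//= enum_ordSl enum_ord0.
Qed.

(** The quotient in direction v + u is the one in direction u at the moving point x + k v plus the
    one in direction v at x. The former converges by [strict_derivative], df being continuous on the
    interior. *)
Let ddir_add x v u : A° x ->
  iter_ddir f [:: v + u] x = iter_ddir f [:: v] x + iter_ddir f [:: u] x.
Proof.
move=> Ax; have [G cG GE] := ddir_ext.
have fG z w : A° z -> diff_quotient f z w h @[h --> 0^'] --> G (z, w).
  by move=> Az; rewrite GE//; exact: (@ddirP [::]).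
have oA : open A° by exact: open_interior.
have oAT : open (A° `*` [set: X]).
  by rewrite -interior_setXT; exact: open_interior.
have cG0 : {within A° `*` setT, continuous G}.
  by apply: continuous_subspaceW cG => p [/interior_subset Ap _].
have cx : (x + k *: v) @[k --> (0 : R)^'] --> x.
  rewrite -[in X in _ --> X](addr0 x) -[in X in _ --> X](scale0r v).
  apply: tvs_cvgD; first exact: cvg_cst.
  by apply: tvs_cvgZ; [exact: nbhs_dnbhs|exact: cvg_cst].
have cu : u @[k --> (0 : R)^'] --> u by exact: cvg_cst.
have Axu : (A° `*` [set: X]) (x, u) by split.
have l1 := strict_derivative oA Ax fG (within_at oAT Axu cG0) cx cu.
rewrite -(GE (x, v) Ax) -(GE (x, u) Ax) [RHS]addrC; apply: lim0E => //.
apply: cvg_trans (tvs_cvgD l1 (fG x v Ax)).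
apply: near_eq_cvg; apply: nearW => k.
by rewrite /diff_quotient -[LHS]scalerDr [k *: (v + u)]scalerDr subrKA addrA.
Qed.

Let ddir_scale x u (c : R) : A° x ->
  iter_ddir f [:: c *: u] x = c *: iter_ddir f [:: u] x.
Proof.
move=> Ax; apply: lim0E => //; have [->|c0] := eqVneq c 0.
  rewrite !scale0r; apply: (@cvg_trans _ ((0 : Y) @[h --> (0 : R)^'])); last exact:
    cvg_cst.
  by apply: near_eq_cvg; apply: nearW => k; rewrite /diff_quotient scaler0 addr0 subrr
    scaler0.
have ch := dnbhs0_mulr c0.
have lc := cvg_comp _ _ ch (@ddirP [::] u _ Ax).
have cc : c @[k --> (0 : R)^'] --> c by exact: cvg_cst.
apply: cvg_trans (tvs_cvgZ cc lc).
apply: near_eq_cvg; apply: nearW => k.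
by rewrite /diff_quotient /= [LHS]scalerA invfM mulrCA divff// mulr1 scalerA.
Qed.

(** For empty m this is the linearity of df(x). The identity holds on an open set, so it can be
    differentiated along the further directions one by one. *)
Lemma iter_ddir_linear m x v u (h : R) : A° x ->
  iter_ddir f ((v + h *: u) :: m) x = iter_ddir f (v :: m) x + h *: iter_ddir f (u :: m)
    x.
Proof.
elim/last_ind: m x => [|m w IH] x Ax; first by rewrite ddir_add// ddir_scale.
rewrite -!rcons_cons iter_ddir_rcons; apply: lim0E => //.
have ch : h @[k --> (0 : R)^'] --> h by exact: cvg_cst.
apply: cvg_trans (tvs_cvgD (@ddirP (v :: m) w _ Ax) (tvs_cvgZ ch (@ddirP (u :: m) w _
  Ax))).
apply: near_eq_cvg; have := near_line w (nbhs_interior Ax); apply: filterS => k Ak.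
rewrite /diff_quotient !IH// scalerA mulrC -scalerA -scalerDr; congr (_ *: _).
by rewrite scalerBr opprD addrACA.
Qed.

Lemma dsum_derivative st (x v w u : X) : A° x ->
  diff_quotient (dsum st) (x, v) (w, u) h @[h --> 0^'] --> dsum (dstep st (w, u)) (x, v).
Proof.
move=> Ax; rewrite {2}/dsum /=.
have rest : diff_quotient (fun z => foldr (fun t y => iter_ddir f t z + y) 0 st.2) x w h
    @[h --> 0^'] --> foldr (fun t y => iter_ddir f t x + y) 0 [seq rcons t w | t <- st.2].
  elim: st.2 => [|t T IH] /=.
    apply: (@cvg_trans _ ((0 : Y) @[h --> (0 : R)^'])); last exact: cvg_cst.
    by apply: near_eq_cvg; apply: nearW => k; rewrite /diff_quotient subrr scaler0.
  apply: cvg_trans (tvs_cvgD (@ddirP t w _ Ax) IH).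
  by apply: near_eq_cvg; apply: nearW => k; rewrite /diff_quotient -scalerDr opprD
    addrACA.
(* Linearity splits the first term, taken at v + h u, into its value at v, which is differentiated
   along w, and h times its value at u. The factor h cancels, and the value at u converges by
   [line_cvg]. *)
apply: cvg_trans (tvs_cvgD (@ddirP (v :: st.1) w _ Ax) (tvs_cvgD (@line_cvg (u :: st.1)
  _ w Ax) rest)).
apply: near_eq_cvg; near=> h.
have h0 : h != 0 by near: h; exact: nbhs_dnbhs_neq.
have Ah : A° (x + h *: w) by near: h; exact: near_line (nbhs_interior Ax).
have := iter_ddir_linear st.1 v u h Ah.
rewrite /diff_quotient pair_line /dsum /= => ->.
rewrite !(scalerDr, scalerN, opprD) scalerA mulVf// scale1r !addrA.
by congr (_ - _); rewrite -!addrA; congr (_ + _); rewrite addrC -addrA.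
Unshelve. all: by end_near. Qed.

Let dsum_eq_derivative (F : X * X -> Y) st x v w u :
  (forall q, A° q.1 -> F q = dsum st q) -> A° x ->
  diff_quotient F (x, v) (w, u) h @[h --> 0^'] --> dsum (dstep st (w, u)) (x, v).
Proof.
move=> FE Ax; have d := @dsum_derivative st x v w u Ax.
have Axv : (A° `*` [set: X])° (x, v).
  by rewrite interior_setXT; split=> //; exact: nbhs_interior.
by apply: (diff_quotient_eq _ Axv d) => q [Aq _]; rewrite FE.
Qed.

Lemma iter_ddir_dsum (F : X * X -> Y) st l p :
  (forall q, A° q.1 -> F q = dsum st q) -> A° p.1 ->
  iter_ddir F l p = dsum (foldl (@dstep X) st l) p.
Proof.
elim: l F st => [|[w u] l IH] F st FE Ap /=; first exact: FE.
apply: IH Ap => -[x v] Ax; apply: lim0E => //.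
exact: dsum_eq_derivative.
Qed.

Lemma iter_smooth_ddir (F : X * X -> Y) :
  {within A `*` setT, continuous F} ->
  (forall p, A° p.1 -> F p = iter_ddir f [:: p.2] p.1) ->
  iter_smooth (A `*` setT) F.
Proof.
move=> cF FE; have {}FE q : A° q.1 -> F q = dsum ([::], [::]) q.
  by move=> Aq; rewrite FE// /dsum /= addr0.
split=> // [l [w u] [x v]|k].
  rewrite interior_setXT => -[Ax _].
  exists (dsum (dstep (foldl (@dstep X) ([::], [::]) l) (w, u)) (x, v)).
  by apply: dsum_eq_derivative Ax => q Aq; exact: iter_ddir_dsum.
pose P : topologicalType := ((X * X) * {ptws 'I_k -> (X * X)%type})%type.
(* Directions depending continuously on p, which consists of the point (x, v) and k directions. With
   them [st] lists the terms of the k-th derivative of F before p is given. *)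
pose S := {phi : P -> X | continuous phi}.
have cproj i : continuous (fun p : P => (p.2 i).1) /\ continuous (fun p : P => (p.2 i).2).
  have c := continuous_compose (@continuous_snd (X * X)%type {ptws 'I_k -> (X *
    X)%type}) (@ptws_proj_continuous _ _ _ i).
  split; first exact: continuous_compose c (@continuous_fst _ _).
  exact: continuous_compose c (@continuous_snd _ _).
pose proj i : S * S := (exist _ _ (cproj i).1, exist _ _ (cproj i).2).
pose st := foldl (@dstep S) ([::], [::]) [seq proj i | i <- enum 'I_k].
have chead : continuous (fun p : P => p.1.2).
  exact: continuous_compose (@continuous_fst _ _) (@continuous_snd _ _).
pose hd : S := exist _ _ chead.
have [_ _ ext] := sf.
pose G j := sval (cid2 (ext j)).
have cG j : {within A `*` setT, continuous (G j)} by rewrite /G; case: cid2.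
have GE j p : A° p.1 -> G j p = iter_ddir f [seq p.2 i | i <- enum 'I_j] p.1.
  by rewrite /G; case: cid2 => g ? gE; exact: gE.
(* The continuous extension of one term of the sum. The direction v, which is [hd], doubles as the
   default of [nth], which is never reached. *)
pose extl (l : seq S) (p : P) : Y := G (size l) (p.1.1, fun i : 'I_(size l) => sval (nth
  hd l i) p).
have cextl l : {within (A `*` setT) `*` setT, continuous (extl l)}.
  apply: (@within_comp _ _ _ _ _ _ (G (size l)) _ (cG _)); last by move=> p [[]].
  apply: continuous_subspaceT; apply: continuous_pair.
    exact: continuous_compose (@continuous_fst _ _) (@continuous_fst _ _).
  by apply: ptws_continuous => i; exact: (svalP (nth hd l i)).
have extlE l p : A° p.1.1 -> extl l p = iter_ddir f [seq sval phi p | phi <- l] p.1.1.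
  move=> Ap; rewrite /extl GE//; congr iter_ddir.
  by rewrite -[in RHS](nth_enum_map hd l) -[RHS]map_comp.
exists (fun p : P => extl (hd :: st.1) p + foldr (fun t y => extl t p + y) 0 st.2).
  have sumc : {within (A `*` setT) `*` setT, continuous (fun p : P => foldr (fun t y =>
    extl t p + y) 0 st.2)}.
    elim: st.2 => [|t T IH] /=; first by apply: continuous_subspaceT => p; exact: cvg_cst.
    by move=> p; exact: tvs_cvgD (cextl t p) (IH p).
  by move=> p; exact: tvs_cvgD (cextl (hd :: st.1) p) (sumc p).
move=> p; rewrite interior_setXT => -[Ap _].
rewrite (iter_ddir_dsum _ FE)//.
have -> : [seq p.2 i | i <- enum 'I_k] =
    [seq (sval wu.1 p, sval wu.2 p) | wu <- [seq proj i | i <- enum 'I_k]].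
  by rewrite -[RHS]map_comp; apply: eq_map => i /=; case: (p.2 i).
rewrite -(@dmap_dstep _ _ (fun phi : S => sval phi p) ([::], [::])) -/st.
rewrite /dsum /= extlE//; congr (_ + _).
by elim: st.2 => [|t T IH] //=; rewrite IH extlE.
Qed.

End iter_to_Cr.

Lemma iter_smooth_Cr (R : realType) n (X Y : tvsType R) (A : set X) (f : X -> Y) :
  hausdorff_space Y -> iter_smooth A f -> Cr n A f.
Proof.
move=> hY; elim: n X A f => [|n IH] X A f sf; first by case: sf.
split; first by case: sf.
have [_ ex /(_ 1%N) [g cg gE]] := sf.
pose F (p : X * X) := g (p.1, fun _ => p.2).
have FE p : A° p.1 -> F p = iter_ddir f [:: p.2] p.1.
  by move=> Ap; rewrite /F gE//= enum_ordSl enum_ord0.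
exists F; split.
  move=> x v Ax; rewrite FE//=; have [y hy] := ex [::] v x Ax.
  by rewrite /ddir (lim0E hY hy).
apply: IH; apply: (iter_smooth_ddir hY sf) => //.
apply: (@within_comp _ _ _ _ _ _ g _ cg) => /=; last by move=> p [].
apply: continuous_subspaceT; apply: continuous_pair; first exact: continuous_fst.
by apply: ptws_continuous => i; exact: continuous_snd.
Qed.

(** * Smooth bump functions *)

Section real_functions.
Context {R : realType}.

Lemma within_continuous_diff_quotient (V : set R^o) (f f' : R^o -> R^o) : open V ->
  (forall t, V t -> diff_quotient f t 1 h @[h --> (0 : R)^'] --> f' t) ->
  {within V, continuous f}.
Proof.
move=> oV ff; rewrite continuous_open_subspace// => t /set_mem Vt.
apply: differentiable_continuous; apply/derivable1_diffP.
apply/cvg_ex; exists (f' t); apply: cvg_trans (ff t Vt).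
by apply: near_eq_cvg; apply: nearW => h; congr (_ *: (f _ - _)); exact: addrC.
Qed.

(** The differential is (t, v) |-> v f'(t), a product of a projection and of f' after a
    projection. *)
Lemma Cr_real n (V : set R^o) (f f' : R^o -> R^o) : open V ->
  (forall t, V t -> diff_quotient f t 1 h @[h --> (0 : R)^'] --> f' t) ->
  Cr n V f' -> Cr n.+1 V f.
Proof.
move=> oV ff Cf'.
have fE t v : V t -> diff_quotient f t v h @[h --> (0 : R)^'] --> v * f' t.
  move=> Vt; have [->|v0] := eqVneq v 0.
    apply: (@cvg_trans _ ((0 : R^o) @[h --> (0 : R)^'])).
      by apply: near_eq_cvg; apply: nearW => k; rewrite /diff_quotient scaler0 addr0
        subrr scaler0.
    by rewrite mul0r; exact: cvg_cst.
  have lc := cvg_comp _ _ (dnbhs0_mulr v0) (ff t Vt).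
  have cv : v @[k --> (0 : R)^'] --> v by exact: cvg_cst.
  apply: cvg_trans (@tvs_cvgZ _ R^o _ _ _ _ _ _ _ cv lc).
  apply: near_eq_cvg; apply: nearW => k.
  rewrite /diff_quotient /= [LHS]scalerA invfM mulrCA divff// mulr1.
  by congr (_ *: (f (_ + _) - _)); rewrite /GRing.scale /= mulr1.
split; first exact: within_continuous_diff_quotient ff.
exists (fun p => p.2 *: f' p.1); split.
  by move=> t v /interior_subset Vt; exact: fE.
apply: Cr_scale.
  apply: (@Cr_affine _ _ _ _ _ snd snd) => //; exact: continuous_snd.
apply: (@Cr_precomp_affine _ _ _ _ _ V _ f' fst fst) => //.
- exact: continuous_fst.
- exact: continuous_fst.
- by move=> p [].
- by move=> p; rewrite interior_setXT => -[].
Qed.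

Lemma is_derive_diff_quotient (f : R^o -> R^o) t d :
  is_derive (t : R^o) 1 f d -> diff_quotient f t 1 h @[h --> (0 : R)^'] --> d.
Proof.
move=> [df <-]; apply: cvg_trans (df).
by apply: near_eq_cvg; apply: nearW => h; congr (_ *: (f _ - _)); exact: addrC.
Qed.

(* The derivative of such a function is again one, for the polynomial
   X^2 (p - p'). *)
Definition flat (p : {poly R}) (t : R) : R :=
  if 0 < t then p.[t^-1] * expR (- t^-1) else 0.

(** With u = 1/t, the estimate e^u >= u^(i+1) / (i+1)! gives u^i e^(-u) <= (i+1)! t for each
    monomial of p. *)
Lemma flat_bound p : exists2 C : R, 0 <= C &
  forall t, 0 < t -> `|flat p t| <= C * t.
Proof.
exists (\sum_(i < size p) `|p`_i| * i.+1`!%:R).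
  by apply: sumr_ge0 => i _; rewrite mulr_ge0.
move=> t t0; rewrite /flat t0 horner_coef mulr_suml mulr_suml.
apply: le_trans (ler_norm_sum _ _ _) _; apply: ler_sum => i _.
rewrite !normrM -!mulrA ler_wpM2l//.
set u := t^-1; have u0 : 0 < u by rewrite invr_gt0.
rewrite ger0_norm ?exprn_ge0 ?(ltW u0)// ger0_norm ?expR_ge0//.
rewrite expRN ler_pdivrMr ?expR_gt0//.
have -> : t = u^-1 by rewrite invrK.
rewrite -mulrA mulrCA ler_pdivlMl// -exprS.
have := expR_ge1Dxn i (ltW u0).
rewrite addrC => /(le_trans _)-/(_ (u ^+ i.+1 / (i.+1)`!%:R)).
rewrite lerDl ler01 => /(_ isT).
by rewrite ler_pdivrMr ?ltr0n ?fact_gt0// mulrC.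
Qed.

Lemma flat_at0 p : flat p h @[h --> (0 : R)] --> (0 : R).
Proof.
have [C C0 bC] := flat_bound p.
have bC' t : `|flat p t| <= C * `|t|.
  have [t0|t0] := ltP 0 t; first by rewrite [`|t|]gtr0_norm// bC.
  by rewrite /flat ltNge t0/= normr0 mulr_ge0.
apply/cvgr0Pnorm_le => e e0.
have e1 : 0 < e / (C + 1) by rewrite divr_gt0// ltr_wpDl.
have := @nbhs0_le _ R^o _ e1; apply: filterS => h he.
apply: le_trans (bC' h) _; apply: (@le_trans _ _ (C * (e / (C + 1)))).
  by rewrite ler_wpM2l.
rewrite mulrCA ler_piMr ?(ltW e0)// ler_pdivrMr ?ltr_wpDl//.
by rewrite mul1r lerDl.
Qed.

Lemma flat_derivative p (t : R^o) :
  diff_quotient (flat p : R^o -> R^o) t 1 h @[h --> (0 : R)^'] --> flat ('X^2 * (p -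
    p^`())) t.
Proof.
have [t0|t0|->] := ltgtP t 0.
- apply: (@diff_quotient_eq _ R^o R^o [set x : R | x < 0] (fun _ => 0)).
  + by move=> x /= x0; rewrite /flat ltNge (ltW x0).
  + exact: lt_nbhsl.
  rewrite /flat ltNge (ltW t0)/=.
  apply: (@cvg_trans _ ((0 : R^o) @[h --> (0 : R)^'])); last exact: cvg_cst.
  by apply: near_eq_cvg; apply: nearW => k; rewrite /diff_quotient subrr scaler0.
- apply: (@diff_quotient_eq _ R^o R^o [set x : R | 0 < x] (fun x => p.[x^-1] * expR (-
  x^-1))).
  + by move=> x /= x0; rewrite /flat x0.
  + exact: lt_nbhsr.
  apply: is_derive_diff_quotient; rewrite /flat t0.
  have tn0 : t != 0 by rewrite gt_eqF.
  have dV : is_derive t 1 (fun x : R => x^-1) (- t ^- 2 *: (1 : R)).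
    by apply: is_deriveV => //; exact: is_derive_id.
  have dN := @is_deriveN _ _ _ _ _ _ _ dV.
  have dE := @is_derive1_comp R expR (- (fun x : R => x^-1)) t _ _ (is_derive_expR _) dN.
  have dP := @is_derive1_comp R (horner p) (fun x : R => x^-1) t _ _ (is_derive_poly p
    _) dV.
  apply: (@is_derive_eq _ _ _ _ _ _ _ _ (is_deriveM dP dE)).
  rewrite hornerM hornerXn hornerD hornerN.
  transitivity (p.[t^-1] * (expR (- t^-1) * - (- t ^- 2 * 1)) +
    expR (- t^-1) * (p^`().[t^-1] * (- t ^- 2 * 1))); first by [].
  by rewrite exprVn; ring.
(* At 0 the difference quotient is itself a flat function, for the polynomial 'X * p, and so tends
   to 0. *)
- have f0 q : flat q 0 = 0 by rewrite /flat ltxx.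
  have := @flat_at0 ('X * p); rewrite f0 => /(cvg_trans _); apply.
  apply: (@cvg_trans _ (flat ('X * p) h @[h --> (0 : R)^'])); last first.
    by apply: cvg_app; exact: nbhs_dnbhs.
  apply: near_eq_cvg; apply: nearW => h.
  rewrite /diff_quotient f0 subr0 add0r /flat /GRing.scale /= mulr1.
  by case: ifP => h0; rewrite ?mulr0// hornerM hornerX mulrA.
Qed.

Lemma Cr_flat n p : Cr n setT (flat p : R^o -> R^o).
Proof.
elim: n p => [|n IH] p.
  apply: (@within_continuous_diff_quotient _ _ (flat ('X^2 * (p - p^`())))).
    exact: openT.
  by move=> t _; exact: flat_derivative.
apply: (@Cr_real _ _ _ (flat ('X^2 * (p - p^`())))) (IH _); first exact: openT.
by move=> t _; exact: flat_derivative.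
Qed.

Lemma open_neq0 : open [set t : R^o | t != 0].
Proof.
rewrite (_ : mkset _ = ~` [set 0]); last by apply/seteqP; split=> t /= /eqP.
by apply: closed_openC; apply: accessible_closed_set1; exact: hausdorff_accessible
  (@norm_hausdorff _ R^o).
Qed.

(** The derivative is written as the product of -t^-1 and t^-1, so that the induction hypothesis
    applies to both factors. *)
Lemma Cr_inv n : Cr n [set t : R^o | t != 0] (fun t => t^-1 : R^o).
Proof.
have oV := open_neq0.
have dV (t : R^o) : t != 0 ->
    diff_quotient (fun t : R^o => t^-1 : R^o) t 1 h @[h --> (0 : R)^'] --> (- t^-1) *:
      t^-1.
  move=> t0; apply: is_derive_diff_quotient.
  apply: (@is_derive_eq _ _ _ _ _ _ _ _ (@is_deriveV _ id t 1 1 t0 _)).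
  transitivity (- t ^- 2 * 1 : R); first by [].
  by rewrite mulr1 -exprVn expr2 /GRing.scale /= mulNr.
elim: n => [|n IH]; first exact: (within_continuous_diff_quotient oV dV).
apply: (Cr_real oV dV); apply: Cr_scale => //.
have -> : (fun t : R^o => - t^-1) = (fun t => (-1 : R^o) *: (t^-1 : R^o)).
  by apply/funext => t; rewrite scaleN1r.
by apply: Cr_scale => //; exact: Cr_cst.
Qed.

Definition smooth_step (t : R) : R := flat 1 t / (flat 1 t + flat 1 (1 - t)).

Lemma flat1_ge0 t : 0 <= flat 1 t.
Proof. by rewrite /flat; case: ifP => // _; rewrite hornerE mul1r expR_ge0. Qed.

Lemma flat1_gt0 t : 0 < t -> 0 < flat 1 t.
Proof. by move=> t0; rewrite /flat t0 hornerE mul1r expR_gt0. Qed.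

Lemma flat1_le0 t : t <= 0 -> flat 1 t = 0.
Proof. by move=> t0; rewrite /flat ltNge t0. Qed.

Lemma smooth_step_denom t : 0 < flat 1 t + flat 1 (1 - t).
Proof.
have [t0|t0] := ltP 0 t; first by rewrite ltr_wpDr ?flat1_ge0// flat1_gt0.
by rewrite ltr_wpDl ?flat1_ge0// flat1_gt0// subr_gt0 (le_lt_trans t0).
Qed.

Lemma smooth_step0 t : t <= 0 -> smooth_step t = 0.
Proof. by move=> t0; rewrite /smooth_step flat1_le0// mul0r. Qed.

Lemma smooth_step1 t : 1 <= t -> smooth_step t = 1.
Proof.
move=> t1; rewrite /smooth_step (@flat1_le0 (1 - t)) ?subr_le0// addr0.
by rewrite divff// gt_eqF// flat1_gt0// (lt_le_trans ltr01).
Qed.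

Lemma smooth_step_bounds t : 0 <= smooth_step t <= 1.
Proof.
rewrite divr_ge0 ?flat1_ge0 ?(ltW (smooth_step_denom _))//=.
by rewrite ler_pdivrMr ?smooth_step_denom// mul1r lerDl flat1_ge0.
Qed.

Lemma Cr_smooth_step n : Cr n setT (smooth_step : R^o -> R^o).
Proof.
have C1 : Cr n setT (fun t : R^o => flat 1 (1 - t) : R^o).
  apply: (@Cr_precomp_affine _ _ _ _ _ setT _ (flat 1 : R^o -> R^o) (fun t : R^o => 1 -
    t : R^o) (fun t : R^o => - t : R^o)) => //.
  - by move=> t; apply: (@tvs_cvgD _ R^o); [exact: cvg_cst|exact: tvs_cvgN].
  - by move=> t; exact: tvs_cvgN.
  - by move=> t w h; rewrite opprD addrA scalerN.
  - by move=> t _; rewrite interiorT.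
  - exact: Cr_flat.
apply: (@Cr_scale _ _ R^o R^o _ (flat 1 : R^o -> R^o)
  (fun t => (flat 1 t + flat 1 (1 - t))^-1 : R^o)); first exact: Cr_flat.
apply: (@Cr_comp _ _ R^o R^o R^o setT [set t : R^o | t != 0]
  (fun t : R^o => flat 1 t + flat 1 (1 - t) : R^o) (fun t => t^-1 : R^o)).
- exact: open_neq0.
- by move=> t _ /=; rewrite gt_eqF// smooth_step_denom.
- exact: Cr_inv.
- by apply: (@Cr_add _ _ R^o R^o) => //; exact: Cr_flat.
Qed.

Lemma Cr_coord n d (i : 'I_d) : Cr n setT (fun v : 'rV[R]_d => v ord0 i : R^o).
Proof.
apply: (@Cr_affine _ _ _ _ _ _ (fun v : 'rV[R]_d => v ord0 i : R^o)).
- exact: coord_continuous.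
- exact: coord_continuous.
- by move=> v w h; rewrite !mxE.
Qed.

Lemma bump_rV d (r : R) : 0 < r -> exists b : 'rV[R]_d -> R^o,
  [/\ forall n, Cr n setT b, forall v, 0 <= b v <= 1,
      forall v i, b v != 0 -> `|v ord0 i| < r &
      \forall v \near (0 : 'rV[R]_d), b v = 1].
Proof.
(* If some coordinate has absolute value at least r = 2 s, then q >= 4 and 2 - q <= 0; near 0 one
   has q < 1 and 2 - q >= 1. A sum of squares is used because the sup norm is not smooth. *)
move=> r0; pose s := r / 2; have s0 : 0 < s by rewrite divr_gt0.
pose q (v : 'rV[R]_d) : R^o := \sum_(i < d) ((v ord0 i / s) ^+ 2).
have Cq n : Cr n setT q.
  rewrite /q; elim: (index_enum _) => [|i l IH].
    apply: (@Cr_eq _ _ _ _ _ (fun _ => 0)) => [v _|]; first by rewrite big_nil.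
    exact: Cr_cst.
  apply: (@Cr_eq _ _ _ _ _ (fun v : 'rV[R]_d => (v ord0 i / s) ^+ 2 + \sum_(i <- l) ((v
    ord0 i / s) ^+ 2) : R^o)) => [v _|]; first by rewrite big_cons.
  apply: (@Cr_add _ _ _ R^o) IH.
  have C1 : Cr n setT (fun v : 'rV[R]_d => v ord0 i / s : R^o).
    apply: (@Cr_scale _ _ _ R^o _ (fun v : 'rV[R]_d => v ord0 i : R^o) (fun _ => s^-1)).
      exact: Cr_coord.
    exact: Cr_cst.
  exact: (@Cr_scale _ _ _ R^o _ _ _ C1 C1).
exists (fun v => smooth_step (2 - q v)); split.
- move=> n; apply: (@Cr_comp _ _ _ R^o R^o setT setT (fun v => 2 - q v : R^o)
  smooth_step) => //.
  + exact: openT.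
  + exact: Cr_smooth_step.
  apply: (@Cr_add _ _ _ R^o); first exact: Cr_cst.
  apply: (@Cr_eq _ _ _ _ _ (fun v => (-1 : R^o) *: (q v : R^o))) => [v _|]; first by
    rewrite scaleN1r.
  by apply: (@Cr_scale _ _ _ R^o); [exact: Cr_cst|exact: Cq].
- by move=> v; exact: smooth_step_bounds.
- move=> v i; apply: contraNT; rewrite -leNgt => ri; apply/eqP/smooth_step0.
  rewrite subr_le0 /q (bigD1 i)//= ler_wpDr//; first by apply: sumr_ge0 => j _; exact:
    sqr_ge0.
  rewrite -[leRHS]ger0_norm ?sqr_ge0// normrX normrM (@ger0_norm _ s^-1) ?invr_ge0 ?(ltW
    s0)//.
  have h2 : 2 <= `|v ord0 i| / s.
    by rewrite ler_pdivlMr// /s mulrCA divff ?mulr1.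
  move: h2; set a := _ / s => h2; nra.
have cq : {for 0, continuous q}.
  apply: (@within_at _ _ setT) => //; first exact: openT.
  exact: (Cq 0%N).
have q0 : q 0 = 0 by rewrite /q big1// => i _; rewrite mxE mul0r expr0n.
have : \forall v \near (0 : 'rV[R]_d), q v < 1.
  by move/(_ [set x : R | x < 1]): cq; apply; rewrite /= q0; exact: lt_nbhsl.
apply: filterS => v qv; apply: smooth_step1.
by rewrite lerBrDr (_ : 2 = 1 + 1)// lerD2l ltW.
Qed.

End real_functions.

(** * Smoothness at a point of a manifold *)

Lemma within_nbhs (X Y : topologicalType) (A : set X) (f : X -> Y) x (P : set Y) :
  {within A, continuous f} -> A x -> nbhs (f x) P ->
  exists2 U, nbhs x U & forall y, A y -> U y -> P (f y).
Proof.
move=> /subspace_continuousP cf Ax Px; exists (fun y => A y -> P (f y)).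
  exact: cf Ax P Px.
by move=> y Ay; exact.
Qed.

Lemma chart_imgP (T E : topologicalType) (c : chart T E) p :
  chart_dom c p -> chart_img c (chart_map c p).
Proof. by move=> cp; exists p. Qed.

Section smooth_at.
Context {R : realType} {d : nat} {T : topologicalType}.
Variable A : set (chart T 'rV[R]_d).

(** The part of [is_corner_atlas] about single charts. It is verified for [prod_atlas] as well, so
    that M and the cylinder share what follows. *)
Definition corner_charts := forall c, A c -> is_chart c /\
  exists2 O : set 'rV[R]_d, open O & chart_img c = O `&` orthant R d.

Definition smooth_at (E : tvsType R) (phi : T -> E) (p : T) :=
  forall c, A c -> chart_dom c p ->
    exists2 U, nbhs (chart_map c p) U &
      forall n, Cr n (chart_img c `&` U) (phi \o chart_inv c).

Hypothesis HA : corner_charts.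

Lemma chart_invK (c : chart T 'rV[R]_d) p : A c -> chart_dom c p -> chart_inv c
  (chart_map c p) = p.
Proof. by move=> /HA[[_ K _ _] _] cp; apply: K; exact: mem_set. Qed.

Lemma chart_near (c : chart T 'rV[R]_d) p (P : set T) : A c -> chart_dom c p -> nbhs p P
  ->
  exists2 U, nbhs (chart_map c p) U &
    forall y, chart_img c y -> U y -> P (chart_inv c y).
Proof.
move=> Ac cp Pp; have [[_ _ _ ci] _] := HA Ac.
by apply: (within_nbhs ci (chart_imgP cp)); rewrite chart_invK.
Qed.

Lemma chart_map_cvg (c : chart T 'rV[R]_d) p : A c -> chart_dom c p ->
  chart_map c q @[q --> p] --> chart_map c p.
Proof. by move=> /HA[[oc _ cc _] _] cp; exact: within_at oc cp cc. Qed.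

Lemma smooth_at_near (E : tvsType R) (phi psi : T -> E) p :
  (\forall q \near p, phi q = psi q) -> smooth_at phi p -> smooth_at psi p.
Proof.
move=> pq sp c Ac cp; have [U nU CU] := sp c Ac cp.
have [W nW WE] := chart_near Ac cp pq.
exists (U `&` W) => [|n]; first exact: filterI.
apply: (@Cr_eq _ _ _ _ _ (phi \o chart_inv c)) => [y [cy [_ Wy]]|]; first exact: WE.
by apply: Cr_sub (CU n) => y [cy [Uy _]].
Qed.

Lemma smooth_at_cst (E : tvsType R) (y : E) p : smooth_at (fun _ => y) p.
Proof. by move=> c Ac cp; exists setT => [|n]; [exact: filterT|exact: Cr_cst]. Qed.

Lemma smooth_at_add (E : tvsType R) (phi psi : T -> E) p :
  smooth_at phi p -> smooth_at psi p -> smooth_at (fun q => phi q + psi q) p.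
Proof.
move=> s1 s2 c Ac cp; have [U nU CU] := s1 c Ac cp; have [W nW CW] := s2 c Ac cp.
exists (U `&` W) => [|n]; first exact: filterI.
apply: (@Cr_add _ _ _ _ _ (phi \o chart_inv c) (psi \o chart_inv c)).
  by apply: Cr_sub (CU n) => y [cy [Uy _]].
by apply: Cr_sub (CW n) => y [cy [_ Wy]].
Qed.

Lemma smooth_at_scale (E : tvsType R) (k : T -> R^o) (phi : T -> E) p :
  smooth_at k p -> smooth_at phi p -> smooth_at (fun q => k q *: phi q) p.
Proof.
move=> s1 s2 c Ac cp; have [U nU CU] := s1 c Ac cp; have [W nW CW] := s2 c Ac cp.
exists (U `&` W) => [|n]; first exact: filterI.
apply: (@Cr_scale _ _ _ _ _ (k \o chart_inv c) (phi \o chart_inv c)).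
  by apply: Cr_sub (CU n) => y [cy [Uy _]].
by apply: Cr_sub (CW n) => y [cy [_ Wy]].
Qed.

Lemma smooth_at_comp (E F : tvsType R) (V : set E) (phi : T -> E) (g : E -> F) p :
  open V -> V (phi p) -> (forall n, Cr n V g) -> smooth_at phi p ->
  smooth_at (g \o phi) p.
Proof.
move=> oV Vp Cg s c Ac cp; have [U nU CU] := s c Ac cp.
have Vc : nbhs ((phi \o chart_inv c) (chart_map c p)) V.
  by rewrite /= chart_invK//; exact: open_nbhs_nbhs.
have [W nW WV] := within_nbhs (CU 0%N) (conj (chart_imgP cp) (nbhs_singleton nU)) Vc.
exists (U `&` W) => [|n]; first exact: filterI.
apply: (@Cr_comp _ _ _ _ _ _ V (phi \o chart_inv c) g oV) => //.
  by move=> y [cy [Uy Wy]]; exact: WV.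
by apply: Cr_sub (CU n) => y [cy [Uy _]].
Qed.

Lemma smooth_at_cvg (E : tvsType R) (phi : T -> E) p (c : chart T 'rV[R]_d) : A c ->
  chart_dom c p ->
  smooth_at phi p -> phi q @[q --> p] --> phi p.
Proof.
move=> Ac cp s Q Qp; have [U nU CU] := s c Ac cp.
have Qc : nbhs ((phi \o chart_inv c) (chart_map c p)) Q by rewrite /= chart_invK.
have [W nW WQ] := within_nbhs (CU 0%N) (conj (chart_imgP cp) (nbhs_singleton nU)) Qc.
have [[oc _ _ _] _] := HA Ac.
have nc : nbhs p (chart_dom c) by exact: open_nbhs_nbhs.
have nUW : nbhs (chart_map c p) (U `&` W) by exact: filterI.
have := chart_map_cvg Ac cp nUW; rewrite !nbhs_filterE /=.
apply: filterS2 nc => q cq [Uq] /(WQ _ (conj (chart_imgP cq) Uq)) /=.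
by rewrite chart_invK.
Qed.

(** Moving y along (1, ..., 1) makes all coordinates positive, and such points close to y are
    interior to B. *)
Lemma near_orthant_dense (B : set 'rV[R]_d) :
  (forall y, B y -> orthant R d y /\ exists2 U, nbhs y U & orthant R d `&` U `<=` B) ->
  B `<=` closure B°.
Proof.
move=> HB y By Q nQ; have [oy [U nU UB]] := HB y By.
pose z (e : R) : 'rV[R]_d := y + e *: const_mx 1.
have cz : z e @[e --> (0 : R)] --> y.
  rewrite -[in X in _ --> X](addr0 y) -[in X in _ --> X](scale0r (const_mx 1)).
  by apply: tvs_cvgD; [exact: cvg_cst|apply: tvs_cvgZ; [exact: cvg_id|exact: cvg_cst]].
have := cz _ (filterI (nbhs_interior nU) nQ).
rewrite nbhs_filterE /= => -[r /= r0 hr].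
have r20 : 0 < r / 2 by rewrite divr_gt0.
have [Uz Qz] : (U° `&` Q) (z (r / 2)).
  by apply: hr => /=; rewrite sub0r normrN gtr0_norm// ltr_pdivrMr// ltr_pMr// ltr1n.
exists (z (r / 2)); split=> //; apply: filterS UB _; apply: filterI => //.
have zpos i : 0 < z (r / 2) ord0 i.
  by rewrite !mxE mulr1 ltr_wpDl// oy.
have near_pos i : \forall w \near z (r / 2), 0 < (w : 'rV[R]_d) ord0 i.
  have := @coord_continuous R 1 d ord0 i (z (r / 2)).
  by move/(_ [set x | 0 < x]); apply; exact: lt_nbhsr.
have := filter_forall (nbhs_filter (z (r / 2))) near_pos.
by apply: filterS => w hw i; exact/ltW.
Qed.

Variable N : lc_manifold R.

(** One chart at f p is a sufficient witness: where f is continuous, [smooth_at_N_chart] passes to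
    any other by composing with a transition map of N, which is defined on an open set. *)
Definition smooth_at_N (f : T -> N) (p : T) := exists (E : tvsType R) (e : chart N E),
  [/\ lcm_atlas N E e, chart_dom e (f p) & smooth_at (chart_map e \o f) p].

Lemma lc_chart_at (q : N) : exists (E : tvsType R) (e : chart N E),
  [/\ lcm_atlas N E e, chart_dom e q, is_chart e, open (chart_img e) & hausdorff_space E].
Proof.
have [H1 H2 _] := lcm_atlasP N; have [E [e Ae eq]] := H2 q.
by exists E, e; have [] := H1 E e Ae.
Qed.

Lemma smooth_at_N_chart (f : T -> N) p (E : tvsType R) (e : chart N E) :
  f q @[q --> p] --> f p -> smooth_at_N f p ->
  lcm_atlas N E e -> chart_dom e (f p) -> smooth_at (chart_map e \o f) p.
Proof.
move=> cf [F [e' [Ae' e'p s]]] Ae ep.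
have [H1 _ H3] := lcm_atlasP N.
have [hE [oe Ke ce cie] oie] := H1 _ _ Ae.
have [hF [oe' Ke' ce' cie'] oie'] := H1 _ _ Ae'.
pose V := local_dom idfun e' e.
have KK q : chart_dom e' q -> chart_inv e' (chart_map e' q) = q.
  by move=> e'q; apply: Ke'; exact: mem_set.
have oV : open V.
  rewrite openE => y [iy /= ey].
  have ne : nbhs (chart_inv e' y) (chart_dom e) by exact: open_nbhs_nbhs.
  have [U nU UE] := within_nbhs cie' iy ne.
  have ni : nbhs y (chart_img e') by exact: open_nbhs_nbhs.
  by rewrite /interior; move: nU; apply: filterS2 ni => z iz Uz; split=> //; exact: UE.
apply: (@smooth_at_near _ (local_rep idfun e' e \o (chart_map e' \o f))).
  have : \forall q \near p, chart_dom e' (f q).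
    by apply: cf; exact: open_nbhs_nbhs.
  by apply: filterS => q e'q; rewrite /local_rep /= KK.
apply: (smooth_at_comp oV) s.
  by split=> /=; [exact: chart_imgP|rewrite KK].
by move=> n; apply: iter_smooth_Cr => //; apply: smooth_on_iter => //; exact: H3.
Qed.

Lemma smooth_map_at (f : T -> N) : smooth_map A f -> forall p, smooth_at_N f p.
Proof.
move=> [cf sf] p; have [E [e [Ae ep [oe Ke ce cie] oie hE]]] := lc_chart_at (f p).
exists E, e; split=> // c Ac cp.
have ne : nbhs p (f @^-1` chart_dom e) by apply: cf; exact: open_nbhs_nbhs.
have [U nU UE] := chart_near Ac cp ne.
exists U => // n; apply: (@Cr_sub _ _ _ _ (local_dom f c e)).
  by move=> y [iy Uy]; split=> //; exact: UE.
by apply: iter_smooth_Cr => //; apply: smooth_iter; exact: sf.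
Qed.

Lemma smooth_at_map (f : T -> N) : continuous f -> (forall p, smooth_at_N f p) ->
  smooth_map A f.
Proof.
move=> cf sf; split=> // E c e Ac Ae.
have [H1 _ _] := lcm_atlasP N.
have [hE [oe Ke ce cie] oie] := H1 _ _ Ae.
have [[oc Kc cc cic] [W oW cO]] := HA Ac.
have near_dom y : local_dom f c e y -> exists p, [/\ chart_dom c p, chart_map c p = y &
  chart_dom e (f p)].
  move=> [[p cp <-]]; rewrite /= chart_invK// => ep; exists p; split=> //.
(* Pointwise smoothness is glued by [Cr_local]. Its density hypothesis holds because [local_dom] is
   relatively open in the orthant. *)
apply/iter_smooth_dense/Cr_iter_smooth => // n; apply: Cr_local => //.
  apply: near_orthant_dense => y dy; have [p [cp yE ep]] := near_dom y dy.
  have iy : chart_img c y by case: dy.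
  move: (iy); rewrite cO => -[Wy oy]; split=> //.
  have ne : nbhs p (f @^-1` chart_dom e) by apply: cf; exact: open_nbhs_nbhs.
  have [U nU UE] := chart_near Ac cp ne.
  exists (W `&` U).
    by apply: filterI; [exact: open_nbhs_nbhs|rewrite -yE].
  move=> z [oz [Wz Uz]]; have iz : chart_img c z by rewrite cO.
  by split=> //; exact: UE.
move=> y dy; have [p [cp yE ep]] := near_dom y dy.
have [U nU CU] := smooth_at_N_chart (@cf p) (sf p) Ae ep Ac cp.
exists U; first by rewrite -yE.
by apply: Cr_sub (CU n) => z [[iz _] Uz].
Qed.

End smooth_at.

(** The common interface of M and the cylinder. Q is both compact and closed because T is not
    assumed to be Hausdorff. *)
Definition has_bumps (R : realType) d (T : topologicalType) (A : set (chart T 'rV[R]_d))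
  :=
  forall (p : T) (P : set T), nbhs p P -> exists (b : T -> R^o) (Q : set T),
  [/\ (forall q, smooth_at A b q) /\ (forall q, 0 <= b q <= 1),
      \forall q \near p, b q = 1, compact Q, closed Q &
      Q `<=` P /\ forall q, b q != 0 -> Q q].

(** * Smoothing on compact sets and along an exhaustion *)

Lemma compact_seq_cover (T : topologicalType) (K : set T) (V : T -> set T) :
  compact K -> (forall p, K p -> nbhs p (V p)) ->
  exists s : seq T, (forall p, p \in s -> K p) /\
    forall x, K x -> exists2 p, p \in s & V p x.
Proof.
move=> /compact_near_coveringP cK KV.
(* A set of lists is large if it contains every list extending some given list of points of K. The
   near-covering form of compactness along this filter yields a finite subcover. *)
pose F (P : set (seq T)) := exists2 s0 : seq T, (forall p, p \in s0 -> K p) &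
  forall s : seq T, {subset s0 <= s} -> P s.
have FF : Filter F.
  split; first by exists [::].
    move=> P Q [s Ks sP] [t Kt tQ]; exists (s ++ t).
      by move=> p; rewrite mem_cat => /orP[/Ks|/Kt].
    move=> u su; split; [apply: sP|apply: tQ] => p ps;
      by apply: su; rewrite mem_cat ps ?orbT.
  by move=> P Q PQ [s Ks sP]; exists s => // t st; apply/PQ/sP.
have [|s Ks sP] := cK _ F (fun s x => exists2 p, p \in s & V p x) FF.
  move=> x Kx; exists (V x, [set s : seq T | x \in s]).
    split; first exact: KV.
    exists [:: x] => [p|s]; first by rewrite inE => /eqP ->.
    by move=> /(_ x); rewrite mem_head; apply.
  by move=> [z s] [/= Vz xs]; exists x.
by exists s; split=> // x Kx; exact: sP s (fun _ => id) x Kx.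
Qed.

Lemma near_all_seq (I : eqType) (T : Type) (F : set_system T) {FF : Filter F}
    (s : seq I) (P : I -> T -> Prop) :
  (forall i, i \in s -> \forall x \near F, P i x) ->
  \forall x \near F, forall i, i \in s -> P i x.
Proof.
elim: s => [|i s IH] sP; first by apply: nearW.
have h1 := sP i (mem_head _ _).
have h2 : \forall x \near F, forall i, i \in s -> P i x.
  by apply: IH => j js; apply: sP; rewrite inE js orbT.
apply: filterS2 h1 h2 => x Pi Ps j; rewrite inE => /predU1P[->//|]; exact: Ps.
Qed.

Section smoothing.
Context {R : realType} {d : nat} {T : topologicalType}.
Variable A : set (chart T 'rV[R]_d).
Hypothesis HA : corner_charts A.
Hypothesis coverA : forall p : T, exists2 c, A c & chart_dom c p.
Hypothesis bumpA : has_bumps A.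
Variable N : lc_manifold R.
Implicit Types (f g : T -> N).

Lemma smooth_at_N_near f g (p : T) : (\forall q \near p, f q = g q) ->
  smooth_at_N A f p -> smooth_at_N A g p.
Proof.
move=> fg [E [e [Ae ep s]]]; exists E, e; split=> //.
  by rewrite -(nbhs_singleton fg).
by apply: smooth_at_near s => //; apply: filterS fg => q /= ->.
Qed.

Lemma smooth_at_continuous (E : tvsType R) (phi : T -> E) p :
  smooth_at A phi p -> phi q @[q --> p] --> phi p.
Proof. by have [c Ac cp] := coverA p; exact: (smooth_at_cvg HA Ac cp). Qed.

Section averaging.
Variables (E : tvsType R) (I : eqType) (b : I -> T -> R^o) (y : I -> E).

(* Where some [b i] is [1], the map [z] is forgotten and only the [b i] matter. *)
Definition average (s : seq I) (z : T -> E) (x : T) : E :=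
  foldl (fun w i => (1 - b i x) *: w + b i x *: y i) (z x) s.

Lemma average_cons i s z :
  average (i :: s) z = average s (fun x => (1 - b i x) *: z x + b i x *: y i).
Proof. by []. Qed.

(** Each step is a convex combination, trivial where the bump vanishes, so closeness to w matters
    only for those y i whose bump is nonzero at x. *)
Lemma average_cvx (C : set E) s z x w : cvx C -> C (z x - w) ->
  (forall i, i \in s -> b i x != 0 -> C (y i - w)) ->
  (forall i, 0 <= b i x <= 1) -> C (average s z x - w).
Proof.
move=> cC Cz Cy b01; elim: s z Cz Cy => [|i s IH] z Cz Cy //.
rewrite average_cons; apply: IH; last first.
  by move=> j js; apply: Cy; rewrite inE js orbT.
have [bi0|bi0] := eqVneq (b i x) 0; first by rewrite bi0 subr0 scale1r scale0r addr0.
have /andP[b0 b1] := b01 i.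
have := cC _ _ _ (Cy i (mem_head _ _) bi0) Cz b0 b1.
rewrite !scalerBr addrACA -opprD -scalerDl [b i x + _]addrC subrK scale1r.
by rewrite [b i x *: _ + _]addrC.
Qed.

Lemma average_id s z x : (forall i, i \in s -> b i x = 0) -> average s z x = z x.
Proof.
elim: s z => [|i s IH] z bs //; rewrite average_cons IH.
  by rewrite bs ?mem_head// subr0 scale1r scale0r addr0.
by move=> j js; apply: bs; rewrite inE js orbT.
Qed.

Hypothesis sb : forall i q, smooth_at A (b i) q.

Let smooth_compl i q : smooth_at A (fun x => 1 - b i x : R^o) q.
Proof.
apply: (@smooth_at_add _ _ _ _ R^o); first exact: smooth_at_cst.
apply: (@smooth_at_near _ _ _ _ HA _ (fun x => (-1 : R^o) *: b i x)).
  by apply: nearW => x; rewrite scaleN1r.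
by apply: (@smooth_at_scale _ _ _ _ R^o); [exact: smooth_at_cst|exact: sb].
Qed.

Lemma average_smooth s z (x : T) : smooth_at A z x \/
    (exists2 i, i \in s & \forall q \near x, b i q = 1) ->
  smooth_at A (average s z) x.
Proof.
elim: s z => [|i s IH] z; first by move=> [//|[]].
rewrite average_cons => -[sz|[j]].
  apply: IH; left; apply: smooth_at_add.
    by apply: smooth_at_scale.
  by apply: smooth_at_scale => //; exact: smooth_at_cst.
rewrite inE => /predU1P[->|js] bj; last by apply: IH; right; exists j.
apply: IH; left; apply: (@smooth_at_near _ _ _ _ HA _ (fun _ => y i)).
  by apply: filterS bj => q ->; rewrite subrr scale0r add0r scale1r.
exact: smooth_at_cst.
Qed.

Lemma average_cvg s (z : T -> E) (x : T) : z q @[q --> x] --> z x ->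
  average s z q @[q --> x] --> average s z x.
Proof.
elim: s z => [|i s IH] z cz //; rewrite average_cons; apply: IH.
apply: tvs_cvgD; apply: tvs_cvgZ => //.
- exact: smooth_at_continuous (@smooth_compl i x).
- exact: smooth_at_continuous (@sb i x).
- exact: cvg_cst.
Qed.

End averaging.

Lemma chart_smoothing (E : tvsType R) (e : chart N E) f (W K : set T) (Om : set (T * N)) :
  lcm_atlas N E e -> continuous f -> compact W -> (forall x, W x -> chart_dom e (f x)) ->
  open Om -> (forall x, Om (x, f x)) -> compact K -> K `<=` W° ->
  exists g, [/\ continuous g, forall x, ~ W x -> g x = f x, forall x, Om (x, g x),
    forall x, smooth_at_N A f x -> smooth_at_N A g x &
    forall x, K x -> smooth_at_N A g x].
Proof.
move=> Ae cf cW We oO fO cK KW.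
have [H1 _ _] := lcm_atlasP N.
have [hE [oe Ke ce cie] oie] := H1 _ _ Ae.
have invK q : chart_dom e q -> chart_inv e (chart_map e q) = q.
  by move=> eq; apply: Ke; exact: mem_set.
have imgP z : chart_img e z ->
    chart_dom e (chart_inv e z) /\ chart_map e (chart_inv e z) = z.
  by move=> [q eq <-]; rewrite invK.
pose ef x := chart_map e (f x).
have cef x : W x -> ef q @[q --> x] --> ef x.
  move=> Wx; apply: (@cvg_comp _ _ _ f (chart_map e) _ (nbhs (f x))); first exact: cf.
  exact: within_at oe (We x Wx) ce.
(* Admissible displacements u of e o f at x. Compactness of W makes one convex neighbourhood C of 0
   admissible for all x in W at once. *)
pose good u x := chart_img e (ef x + u) /\ Om (x, chart_inv e (ef x + u)).
have [C [cC oC C0 CG]] : exists C : set E, [/\ cvx C, open C, C 0 &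
    forall u x, C u -> W x -> good u x].
  suff /nbhs_cvx [C [cC oC C0 CG]] : \forall u \near (0 : E), W `<=` good u.
    by exists C; split=> // u x /CG; apply.
  move/compact_near_coveringP : (cW) => /(_ E (nbhs (0 : E)) good); apply.
  move=> x Wx.
  have ix : chart_img e (ef x) by apply: chart_imgP; exact: We.
  have cadd : (ef zu.1 + zu.2) @[zu --> (x, 0 : E)] --> ef x.
    rewrite -[in X in _ --> X](addr0 (ef x)); apply: tvs_cvgD.
      by apply: (@cvg_comp _ _ _ fst ef _ (nbhs x)); [exact: cvg_fst|exact: cef].
    exact: cvg_snd.
  have near_img : \forall zu \near (x, 0 : E), chart_img e (ef zu.1 + zu.2).
    by apply: cadd; exact: open_nbhs_nbhs.
  apply: filterI => //.
  have Ox : nbhs (x, chart_inv e (ef x)) Om.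
    by rewrite invK; [exact: open_nbhs_nbhs|exact: We].
  have cpair : (zu.1, chart_inv e (ef zu.1 + zu.2)) @[zu --> (x, 0 : E)] -->
      (x, chart_inv e (ef x)).
    apply: cvg_pair; first exact: cvg_fst.
    by apply: (@cvg_comp _ _ _ _ (chart_inv e) _ (nbhs (ef x))); [exact: cadd|exact:
      within_at oie ix cie].
  exact: cpair.
(* The support of the bump at p is so small that ef p differs from the values of ef there by
   elements of C; averaging with such ef p then moves ef x by an element of C. Outside K the zero
   function keeps the family total and smooth. *)
have hb p : exists bQ : (T -> R^o) * set T,
    [/\ forall q, smooth_at A bQ.1 q, forall q, 0 <= bQ.1 q <= 1 & K p ->
    [/\ \forall q \near p, bQ.1 q = 1, closed bQ.2, bQ.2 `<=` W° &
      forall q, bQ.1 q != 0 -> bQ.2 q /\ C (ef p - ef q)]].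
  have [Kp|nKp] := pselect (K p); last first.
    exists (fun _ => 0, set0); split=> // q; first exact: smooth_at_cst.
    by rewrite lexx ler01.
  have Wp := KW _ Kp.
  have nP : nbhs p (W° `&` [set q | C (ef p - ef q)]).
    apply: filterI; first exact: nbhs_interior.
    have : ef p - ef q @[q --> p] --> ef p - ef p.
      apply: tvs_cvgD; first exact: cvg_cst.
      by apply: tvs_cvgN; apply: cef; exact: interior_subset.
    by rewrite subrr; apply; exact: open_nbhs_nbhs.
  have [b [Q [[sb b01] b1 _ cQ [QP bQ]]]] := bumpA nP.
  exists (b, Q); split=> // _; split=> //; first by move=> q /QP[].
  by move=> q /bQ Qq; split=> //; have [] := QP q Qq.
have [bQ bQP] := choice hb.
pose b p := (bQ p).1.
have sb p : forall q, smooth_at A (b p) q by have [] := bQP p.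
have b01 p : forall q, 0 <= b p q <= 1 by have [] := bQP p.
have {}bQP p : K p -> _ := let: And3 _ _ h := bQP p in h.
have [p Kp|s [sK Ks]] := @compact_seq_cover _ K (fun p => [set q | b p q = 1]°) cK.
  by apply: nbhs_interior; have [] := bQP p Kp.
pose Z := average b ef s ef.
have ZC x : W x -> C (Z x - ef x).
  move=> Wx; apply: average_cvx => //; first by rewrite subrr.
  by move=> p ps; have Kp := sK p ps; move=> bp; have [_ _ _ /(_ x bp)[]] := bQP p Kp.
have Zgood x : W x -> chart_img e (Z x) /\ Om (x, chart_inv e (Z x)).
  by move=> Wx; have := CG _ x (ZC x Wx) Wx; rewrite /good addrC subrK.
pose g x := if `[< W x >] then chart_inv e (Z x) else f x.
have gW x : W x -> g x = chart_inv e (Z x) by move=> Wx; rewrite /g asboolT.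
have gnW x : ~ W x -> g x = f x by move=> Wx; rewrite /g asboolF.
(* There is no seam at the boundary of W: the finitely many supports are closed and lie in the
   interior of W, so near a point outside this interior all bumps vanish and both formulas give
   f. *)
have goff x : ~ W° x -> \forall q \near x, f q = g q.
  move=> Wx; have : \forall q \near x, forall p, p \in s -> ~ (bQ p).2 q.
    apply: near_all_seq => p ps; have [_ cQ QW _] := bQP p (sK p ps).
    by apply: open_nbhs_nbhs; split; [exact: closed_openC|move=> /QW].
  apply: filterS => q sq; have [Wq|nWq] := pselect (W q); last by rewrite gnW.
  rewrite gW// /Z average_id ?invK//; first exact: We.
  move=> p ps; have Kp := sK p ps; apply/eqP/negPn/negP => bp.
  by have [_ _ _ /(_ q bp)[/(sq p ps)]] := bQP p Kp.
have gon x : W° x -> \forall q \near x, (chart_map e \o g) q = Z q.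
  move=> Wx; apply: filterS (Wx) => q Wq /=.
  by rewrite gW//; have [/imgP[]] := Zgood q Wq.
have cg : continuous g.
  move=> x; have [Wx|nWx] := pselect (W° x); last first.
    have gx := goff x nWx; rewrite /continuous_at -(nbhs_singleton gx).
    by apply: cvg_trans (cf x); exact: near_eq_cvg.
  have Wx' := interior_subset Wx; have [ix _] := Zgood x Wx'.
  rewrite /continuous_at gW//.
  apply: (@cvg_trans _ (chart_inv e (Z q) @[q --> x])).
    by apply: near_eq_cvg; apply: filterS Wx => q /= Wq; rewrite gW.
  apply: (@cvg_comp _ _ _ Z (chart_inv e) _ (nbhs (Z x))).
    by apply: average_cvg => //; exact: cef.
  exact: within_at oie ix cie.
have glocus x : W° x -> smooth_at A Z x -> smooth_at_N A g x.
  move=> Wx sZ; exists E, e; have [/imgP[ez _] _] := Zgood x (interior_subset Wx).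
  split=> //; first by rewrite gW//; exact: interior_subset.
  by apply: (smooth_at_near HA _ sZ); apply: filterS (gon x Wx) => q ->.
exists g; split=> //.
- move=> x; have [Wx|nWx] := pselect (W x); last by rewrite gnW.
  by rewrite gW//; have [] := Zgood x Wx.
- move=> x fx; have [Wx|nWx] := pselect (W° x); last exact: smooth_at_N_near (goff x
  nWx) fx.
  apply: glocus => //; apply: average_smooth => //; left.
  apply: (smooth_at_N_chart HA (@cf x) fx Ae).
  by apply: We; exact: interior_subset.
- move=> x Kx; apply: glocus; first exact: KW.
  apply: average_smooth => //; right; have [p ps /= px] := Ks x Kx.
  by exists p.
Qed.

(** A modification in one chart must not push the sets W of the remaining points out of their chart
    domains. This is a condition on the graph, open because each W is closed and each chart domain
    open, and [chart_smoothing] preserves it as its [Om]. *)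
Lemma compact_smoothing f (L U : set T) :
  continuous f -> compact L -> open U -> L `<=` U ->
  exists g, [/\ continuous g, forall x, ~ U x -> g x = f x,
    forall x, smooth_at_N A f x -> smooth_at_N A g x &
    forall x, L x -> smooth_at_N A g x].
Proof.
move=> cf cL oU LU.
(* The model space of N depends on p. What the chart can do is packed into a statement that does not
   mention it, so that [choice] yields a family of sets only. *)
have hWK p : exists WKD : set T * set T * set N, L p ->
    [/\ [/\ closed WKD.1.1, WKD.1.1 `<=` U, nbhs p WKD.1.2 & open WKD.2],
      forall x, WKD.1.1 x -> WKD.2 (f x) &
      forall h (Om : set (T * N)), continuous h -> open Om -> (forall x, Om (x, h x)) ->
        (forall x, WKD.1.1 x -> WKD.2 (h x)) ->
        exists g, [/\ continuous g, forall x, ~ WKD.1.1 x -> g x = h x,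
          forall x, Om (x, g x), forall x, smooth_at_N A h x -> smooth_at_N A g x &
          forall x, WKD.1.2 x -> smooth_at_N A g x]].
  have [Lp|nLp] := pselect (L p); last by exists (set0, set0, set0).
  have [E [e [Ae ep [oe _ _ _] oie hE]]] := lc_chart_at (f p).
  have nP : nbhs p (U `&` f @^-1` chart_dom e).
    apply: filterI; first by apply: open_nbhs_nbhs; split=> //; exact: LU.
    by apply: cf; exact: open_nbhs_nbhs.
  have [b [W [_ b1 cW clW [WP bW]]]] := bumpA nP.
  have nW : nbhs p W.
    by apply: filterS b1 => q bq; apply: bW; rewrite bq oner_eq0.
  have [b' [K [_ b'1 cK _ [KW b'K]]]] := bumpA (nbhs_interior nW).
  have nK : nbhs p K.
    by apply: filterS b'1 => q bq; apply: b'K; rewrite bq oner_eq0.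
  exists (W, K, chart_dom e) => _; split=> /=; first by split=> // x /WP[].
    by move=> x /WP[].
  by move=> h Om ch oOm hOm Wh; exact: (chart_smoothing Ae ch cW Wh oOm hOm cK KW).
have [WKD WKDP] := choice hWK.
pose W p := (WKD p).1.1; pose K p := (WKD p).1.2; pose D p := (WKD p).2.
have [p Lp|s [sL Ls]] := @compact_seq_cover _ L K cL.
  by have [[]] := WKDP p Lp.
pose Om := [set xn : T * N | forall p, p \in s -> W p xn.1 -> D p xn.2].
have oOm : open Om.
  rewrite openE => -[x n] /= xn.
  apply: (@near_all_seq _ _ (nbhs (x, n)) _ s (fun p (yk : T * N) => W p yk.1 -> D p
    yk.2)) => p ps.
  have [[cW _ _ oD] _ _] := WKDP p (sL p ps).
  have [Wx|nWx] := pselect (W p x).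
    have : nbhs n (D p) by apply: open_nbhs_nbhs; split=> //; exact: xn.
    by move=> nD; exists (setT, D p) => [|[x' n'] [_ Dn] _] //=; split=> //; exact:
      filterT.
  have nW : nbhs x (~` W p) by apply: open_nbhs_nbhs; split=> //; exact: closed_openC.
  by exists (~` W p, setT) => [|[x' n'] [nWx' _] /nWx'] //=; split=> //; exact: filterT.
have fOm x : Om (x, f x).
  by move=> p ps Wx; have [_ + _] := WKDP p (sL p ps); apply.
suff smooth_list : forall t : seq T, {subset t <= s} ->
    exists g, [/\ continuous g, forall x, ~ U x -> g x = f x, forall x, Om (x, g x),
      forall x, smooth_at_N A f x -> smooth_at_N A g x &
      forall p x, p \in t -> K p x -> smooth_at_N A g x].
  have [g [cg gU gOm fg gs]] := smooth_list s (fun _ => id).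
  by exists g; split=> // x /Ls[p ps Kx]; exact: gs Kx.
elim=> [_|p t IH ts]; first by exists f; split.
have ps : p \in s by apply: ts; rewrite mem_head.
have [|g [cg gU gOm fg gt]] := IH; first by move=> q qt; apply: ts; rewrite inE qt orbT.
have [[_ WU _ _] _ step] := WKDP p (sL p ps).
have [g' [cg' g'W g'Om gg' g'K]] := step g Om cg oOm gOm (fun x => gOm x p ps).
exists g'; split=> // [x nU|x fx|q x].
- by rewrite g'W ?gU// => /WU.
- exact/gg'/fg.
- by rewrite inE => /predU1P[->|qt Kx]; [exact: g'K|apply: gg'; exact: gt Kx].
Qed.

Lemma exhaustion_smoothing f (S : nat -> set T) (C U : set T) :
  (forall m, compact (S m)) -> (forall m, closed (S m)) ->
  (forall m, S m `<=` (S m.+1)°) -> (forall x, exists m, S m x) ->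
  continuous f -> closed C -> open U -> C `<=` U ->
  exists g, [/\ continuous g, forall x, ~ U x -> g x = f x,
    forall x, smooth_at_N A f x -> smooth_at_N A g x &
    forall x, C x -> smooth_at_N A g x].
Proof.
move=> cS clS SS covS cf clC oU CU.
(* The compact sets are shifted by two, so that the first two are empty. *)
pose Q m : set T := if m is m'.+2 then S m' else set0.
have cQ m : compact (Q m) by case: m => [|[|m]] //=; exact: compact0.
have clQ m : closed (Q m) by case: m => [|[|m]] //=; exact: closed0.
have QQ m : Q m `<=` (Q m.+1)° by case: m => [|[|m]] //=.
have Qle m n x : (m <= n)%N -> Q m x -> Q n x.
  move=> /subnK <-; elim: (n - m)%N => [//|k IH] /IH.
  by rewrite addSn => /QQ/interior_subset.
have covQ x : exists m, Q m x by have [m Sx] := covS x; exists m.+2.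
(* Stage m smooths [L m] and leaves [Q m] alone, which is possible since [Q m] lies in the interior
   of [Q m.+1], removed from [L m]. On [Q m] the maps are therefore constant from stage m on. *)
pose L m := C `&` Q m.+2 `&` ~` (Q m.+1)°.
have hstep (mg : nat * (T -> N)) : exists g, continuous mg.2 ->
    [/\ continuous g, forall x, ~ (U `&` ~` Q mg.1) x -> g x = mg.2 x,
      forall x, smooth_at_N A mg.2 x -> smooth_at_N A g x &
      forall x, L mg.1 x -> smooth_at_N A g x].
  have [cg|ncg] := pselect (continuous mg.2); last by exists f.
  have [||||g Hg] := @compact_smoothing mg.2 (L mg.1) (U `&` ~` Q mg.1) => //.
  - apply: (subclosed_compact _ (cQ mg.1.+2)); last by move=> x [[]].
    by apply: closedI; [apply: closedI|apply: open_closedC; exact: open_interior].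
  - by apply: openI => //; exact: closed_openC.
  - by move=> x [[Cx _] nQ]; split; [exact: CU|move=> /QQ].
  by exists g.
have [step stepP] := choice hstep.
pose F := fix F m : T -> N := if m is m'.+1 then step (m', F m') else f.
have cF m : continuous (F m).
  by elim: m => //= m IH; have [] := stepP (m, F m) IH.
have FU m x : ~ U x -> F m x = f x.
  move=> nU; elim: m => //= m <-; have [_ + _ _] := stepP (m, F m) (cF m).
  by apply; move=> [].
have Fstep m x : Q m x -> F m.+1 x = F m x.
  move=> Qx; have [_ + _ _] := stepP (m, F m) (cF m); apply.
  by move=> [].
have Fsmooth m x : smooth_at_N A (F m) x -> smooth_at_N A (F m.+1) x.
  by have [_ _ + _] := stepP (m, F m) (cF m); apply.
have Fle m n x : (m <= n)%N -> smooth_at_N A (F m) x -> smooth_at_N A (F n) x.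
  by move=> /subnK <-; elim: (n - m)%N => [//|k IH] /IH; rewrite addSn => /Fsmooth.
have Feq m n x : (m <= n)%N -> Q m x -> F n x = F m x.
  move=> /subnK <- Qx; elim: (n - m)%N => [//|k IH].
  rewrite addSn Fstep//; apply: Qle Qx; exact: leq_addl.
have [k kP] := choice covQ.
pose g x := F (k x) x.
have gE m x : Q m x -> g x = F m x.
  move=> Qx; rewrite /g; have [km|/ltnW mk] := leqP (k x) m.
    by rewrite [RHS](@Feq (k x)).
  by rewrite (@Feq m).
have gnear m x : Q m x -> \forall q \near x, F m.+1 q = g q.
  by move=> /QQ; apply: filterS => q Qq; rewrite (@gE m.+1).
exists g; split.
- move=> x; have gx := gnear _ _ (kP x).
  rewrite /continuous_at -(nbhs_singleton gx).
  by apply: cvg_trans (cF (k x).+1 x); exact: near_eq_cvg.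
- by move=> x nU; rewrite /g FU.
- move=> x fx; apply: (smooth_at_N_near (gnear _ _ (kP x))).
  exact: (@Fle 0).
move=> x Cx; apply: (smooth_at_N_near (gnear _ _ (kP x))).
have : exists m, `[< Q m x >] by have [m Qx] := covQ x; exists m; exact/asboolP.
(* The least index of a [Q] containing x is at least 2, the first two being empty. If it is m + 2,
   minimality keeps x out of [Q m.+1], so x lies in [L m] and is smoothed at stage m. *)
move=> /ex_minnP[[|[|m]]] /asboolP // Qx mmin.
apply: (@Fle m.+1).
  by apply: leq_trans (leqnSn _) _; apply: ltnW; rewrite ltnS mmin//; exact/asboolP.
have [_ _ _] := stepP (m, F m) (cF m); apply; split=> // /interior_subset Q1.
by have := mmin m.+1 (asboolT Q1); rewrite ltnn.
Qed.

End smoothing.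

(** * Manifolds with corners and cylinders over them *)

Lemma rV_box_nbhs (R : realType) d (x : 'rV[R]_d) (U : set 'rV[R]_d) : nbhs x U ->
  exists2 r : R, 0 < r & forall v : 'rV[R]_d, (forall i, `|v ord0 i - x ord0 i| <= r) ->
    U v.
Proof.
move=> /nbhs_ballP[e /= e0 eU]; exists (e / 2); first by rewrite divr_gt0.
move=> v vx; apply: eU; split=> // i j; rewrite (ord1 i) -ball_normE /=.
rewrite distrC; apply: le_lt_trans (vx j) _.
by rewrite ltr_pdivrMr// ltr_pMr// ltr1n.
Qed.

Lemma rV_continuous (R : realType) d (X : topologicalType) (f : X -> 'rV[R]_d) :
  (forall i, continuous (fun x => f x ord0 i : R)) -> continuous f.
Proof.
move=> cf x P /rV_box_nbhs[r r0 rP].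
have fx i : \forall y \near x, `|f y ord0 i - f x ord0 i| <= r.
  have := cf i x; move/cvgrPdist_le => /(_ r r0).
  by apply: filterS => y; rewrite distrC.
rewrite nbhs_filterE /=; have := filter_forall (nbhs_filter x) fx.
by apply: filterS => y; exact: rP.
Qed.

Lemma orthant_box_compact (R : realType) d (x : 'rV[R]_d) (r : R) :
  compact [set v : 'rV[R]_d | orthant R d v /\ forall i, `|v ord0 i - x ord0 i| <= r].
Proof.
have := @rV_compact R d (fun i => `[Num.max 0 (x ord0 i - r), x ord0 i + r]%classic)
  (fun i => @segment_compact R _ _).
congr compact; apply/seteqP; split=> v /=.
  move=> vx; split=> i; have := vx i; rewrite in_itv /= ge_max => /andP[/andP[v0 v1] v2]
    //.
  by rewrite ler_distl v1.
move=> [v0 vx] i; rewrite in_itv /= ge_max v0 /=.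
by have := vx i; rewrite ler_distl.
Qed.

Section corner_manifold.
Context {R : realType} (M : corner_manifold R).
Let A := cm_atlas M.

Lemma cm_charts : corner_charts A.
Proof. by have [] := cm_atlasP M. Qed.

Lemma cm_cover (p : M) : exists2 c, A c & chart_dom c p.
Proof. by have [_ + _] := cm_atlasP M; apply. Qed.

(** The compatibility of the charts of M enters here, and through this lemma into the bump
    functions: [smooth_at] tests a chart map in all other charts. *)
Lemma cm_chart_smooth (c : chart M 'rV[R]_(cm_dim M)) (p : M) :
  A c -> chart_dom c p -> smooth_at A (chart_map c) p.
Proof.
move=> Ac cp c' Ac' c'p; have [_ _ tr] := cm_atlasP M.
have [[oc _ _ _] _] := cm_charts Ac.
have nc : nbhs p (chart_dom c) by exact: open_nbhs_nbhs.
have [W nW WE] := chart_near cm_charts Ac' c'p nc.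
have dp : local_dom idfun c' c (chart_map c' p).
  by split; [exact: chart_imgP|rewrite /= (chart_invK cm_charts)].
have [U [fx [oU Up sfx fE]]] := tr c' c Ac' Ac _ dp.
exists (W `&` U) => [|n]; first by apply: filterI => //; exact: open_nbhs_nbhs.
apply: (@Cr_eq _ _ _ _ _ fx).
  move=> y [iy [Wy Uy]]; apply: fE; apply/mem_set; split=> //; split=> //; exact: WE.
apply: (@Cr_sub _ _ _ _ U); first by move=> y [_ []].
apply: iter_smooth_Cr; first exact: norm_hausdorff.
by apply: smooth_on_iter => //; exact: norm_hausdorff.
Qed.

(** A bump in a chart is extended by zero. Its support lies in Q, the image of a box so small that
    its part in the orthant stays within the image of the chart. Being compact, Q is closed in the
    Hausdorff space M, whence smoothness outside the chart domain. *)
Lemma cm_bump : has_bumps A.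
Proof.
move=> p P nP; have [c Ac cp] := cm_cover p.
have [[oc Kc cc cic] [W oW cW]] := cm_charts Ac.
have [U nU UE] := chart_near cm_charts Ac cp nP.
have Wp : W (chart_map c p) by have := chart_imgP cp; rewrite cW => -[].
have [r r0 rUW] : exists2 r : R, 0 < r & forall v : 'rV[R]_(cm_dim M),
    (forall i, `|v ord0 i - chart_map c p ord0 i| <= r) -> U v /\ W v.
  by apply: rV_box_nbhs; apply: filterI => //; exact: open_nbhs_nbhs.
have [beta [Cb b01 bsupp b1]] := bump_rV (cm_dim M) r0.
pose B := [set v : 'rV[R]_(cm_dim M) | orthant R (cm_dim M) v /\
  forall i, `|v ord0 i - chart_map c p ord0 i| <= r].
have BW : B `<=` chart_img c by move=> v [ov /rUW[_ Wv]]; rewrite cW.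
pose Q := chart_inv c @` B.
have cQ : compact Q.
  apply: continuous_compact; last exact: orthant_box_compact.
  exact: continuous_subspaceW cic.
have clQ : closed Q by apply: compact_closed => //; exact: cm_hausdorff.
pose b q : R^o := if `[< chart_dom c q >] then beta (chart_map c q - chart_map c p) else
  0.
have bc q : chart_dom c q -> b q = beta (chart_map c q - chart_map c p).
  by move=> cq; rewrite /b asboolT.
have bQ q : b q != 0 -> Q q.
  rewrite /b; case: asboolP => [cq bq|_]; last by rewrite eqxx.
  exists (chart_map c q); last by rewrite (chart_invK cm_charts).
  split; first by have := chart_imgP cq; rewrite cW => -[].
  by move=> i; have := bsupp _ i bq; rewrite !mxE => /ltW.
have sc q : chart_dom c q -> smooth_at A (fun q => chart_map c q - chart_map c p) q.
  move=> cq; apply: smooth_at_add; first exact: cm_chart_smooth.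
  exact: smooth_at_cst.
exists b, Q; split=> //.
- split=> q; last by rewrite /b; case: asboolP => _; rewrite ?b01// lexx ler01.
  have [cq|ncq] := pselect (chart_dom c q).
    apply: (@smooth_at_near _ _ _ _ cm_charts _ (beta \o (fun q => chart_map c q -
      chart_map c p))).
      by apply: filterS (open_nbhs_nbhs (conj oc cq)) => q' cq'; rewrite bc.
    exact: (smooth_at_comp cm_charts openT Logic.I Cb (sc q cq)).
  have nQ : nbhs q (~` Q).
    apply: open_nbhs_nbhs; split; first exact: closed_openC.
    move=> [v /BW[q' cq' <-]]; rewrite (chart_invK cm_charts)// => q'q.
    by apply: ncq; rewrite -q'q.
  apply: (@smooth_at_near _ _ _ _ cm_charts _ (fun _ => 0)); last exact: smooth_at_cst.
  apply: filterS nQ => q' nq'; apply/esym/eqP/negPn/negP => /bQ; exact: nq'.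
- have cb : chart_map c q - chart_map c p @[q --> p] --> (0 : 'rV[R]_(cm_dim M)).
    rewrite -(subrr (chart_map c p)); apply: tvs_cvgD; last exact: cvg_cst.
    exact: (chart_map_cvg cm_charts Ac cp).
  have := cb _ b1; rewrite nbhs_filterE /=.
  by apply: filterS2 (open_nbhs_nbhs (conj oc cp)) => q cq; rewrite bc.
split=> // _ [v Bv <-]; apply: UE; first exact: BW.
by case: Bv => _ /rUW[].
Qed.

End corner_manifold.

(** Starting from a point, [step] collects the closures of the members of a locally finite cover by
    relatively compact open sets that meet K. Finitely many of them meet a compact set. The union of
    the iterates is open since [step K] is a neighbourhood of K, and closed since a member of the
    cover around a limit point meets some iterate. *)
Lemma compact_exhaustion (T : topologicalType) :
  hausdorff_space T -> paracompact T -> connected [set: T] ->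
  (forall p : T, exists2 Q, compact Q & nbhs p Q) ->
  exists S : nat -> set T, [/\ forall m, compact (S m), forall m, closed (S m),
    forall m, S m `<=` (S m.+1)° & forall x, exists m, S m x].
Proof.
move=> hT pT cT lcT.
(* The empty space counts as connected. *)
have [[x0 _]|nT] := pselect (exists x : T, True); last first.
  exists (fun _ => set0); split=> [m|m|m|x]; [exact: compact0|exact: closed0|exact:
    sub0set|].
  by exfalso; apply: nT; exists x.
pose U := [set B : set T | open B /\ exists2 Q, compact Q & B `<=` Q].
have [V [[Vo Vcov] Vlf Vref]] : exists V : set_system T,
    [/\ open_cover V, locally_finite V & forall B, V B -> exists2 C, U C & B `<=` C].
  apply: pT; split; first by move=> B [].
  apply/seteqP; split=> // x _; have [Q cQ nQ] := lcT x.
  exists Q° => //; split; first exact: open_interior.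
  by exists Q => //; exact: interior_subset.
have cV B : V B -> compact (closure B).
  move=> /Vref[C [_ [Q cQ CQ]] BC].
  apply: (subclosed_compact _ cQ); first exact: closed_closure.
  move=> x Bx; apply: (compact_closed hT cQ).
  by apply: closure_subset Bx; exact: subset_trans CQ.
pose star (K : set T) := [set B | V B /\ B `&` K !=set0].
pose step K := \bigcup_(B in star K) closure B.
have fstar K : compact K -> finite_set (star K).
  move=> cK; pose W x := sval (cid2 (Vlf x)).
  have nW x : nbhs x (W x) by rewrite /W; case: cid2.
  have fW x : finite_set (star (W x)) by rewrite /W; case: cid2.
  have [s [_ sK]] := compact_seq_cover cK (fun p _ => nW p).
  apply: (@sub_finite_set _ _ (\bigcup_(x in [set` s]) star (W x))).
    move=> B [VB [y [By Ky]]]; have [p ps Wy] := sK y Ky.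
    by exists p => //; split=> //; exists y.
  by apply: bigcup_finite => [|x _]; [exact: finite_seq|exact: fW].
have cstep K : compact K -> compact (step K).
  move=> /fstar/finite_seqP[s sE]; rewrite /step sE bigcup_seq big_seq.
  by apply: bigsetU_compact => B Bs; apply: cV; have [] : star K B by rewrite sE.
have sub_step K : K `<=` (step K)°.
  move=> x Kx; have : (\bigcup_(B in V) B) x by rewrite Vcov.
  move=> [B VB Bx]; have nB : nbhs x B by apply: open_nbhs_nbhs; split=> //; exact: Vo.
  apply: filterS nB => y By; exists B; last exact: subset_closure.
  by split=> //; exists x.
pose S := fix S m := if m is m'.+1 then step (S m') else [set x0].
have cS m : compact (S m) by elim: m => [|m IH]; [exact: compact_set1|exact: cstep].
exists S; split=> [m|m|m|x]; [exact: cS|exact: compact_closed|exact: sub_step|].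
pose G := \bigcup_m S m.
suff GT : G = setT by have [m _ Sx] : G x by [rewrite GT]; exists m.
apply: cT.
- by exists x0, 0%N.
- exists G; last by rewrite setTI.
  rewrite openE => y [m _ /sub_step ny]; apply: filterS ny => z Sz; by exists m.+1.
- exists G; last by rewrite setTI.
  move=> y Gy; have : (\bigcup_(B in V) B) y by rewrite Vcov.
  move=> [B VB By]; have nB : nbhs y B by apply: open_nbhs_nbhs; split=> //; exact: Vo.
  have [z [[m _ Sz] Bz]] := Gy B nB.
  exists m.+1 => //; exists B; last exact: subset_closure.
  by split=> //; exists z.
Qed.

(** * Block matrices, the unit interval and product charts *)

Section block_matrices.
Context {R : realType} {d1 d2 : nat}.

Lemma row_mx_continuous :
  continuous (fun p : 'rV[R]_d1 * 'rV[R]_d2 => row_mx p.1 p.2).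
Proof.
apply: rV_continuous => i.
rewrite (_ : (fun p0 : 'rV[R]_d1 * 'rV[R]_d2 => (row_mx p0.1 p0.2 : 'rV[R]_(d1 + d2))
  ord0 i) =
  fun p0 => match fintype.split i with inl j => p0.1 ord0 j | inr j => p0.2 ord0 j end);
    last first.
  by apply/funext => q; rewrite mxE.
case: (fintype.split i) => j.
  exact: (continuous_compose (@continuous_fst _ _) (@coord_continuous R 1 d1 ord0 j)).
exact: (continuous_compose (@continuous_snd _ _) (@coord_continuous R 1 d2 ord0 j)).
Qed.

Lemma lsubmx_continuous : continuous (@lsubmx R 1 d1 d2).
Proof.
apply: rV_continuous => i.
rewrite (_ : (fun y : 'rV[R]_(d1 + d2) => (lsubmx y : 'rV[R]_d1) ord0 i) = fun y => y
  ord0 (lshift d2 i)).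
  exact: coord_continuous.
by apply/funext => y; rewrite mxE.
Qed.

Lemma rsubmx_continuous : continuous (@rsubmx R 1 d1 d2).
Proof.
apply: rV_continuous => i.
rewrite (_ : (fun y : 'rV[R]_(d1 + d2) => (rsubmx y : 'rV[R]_d2) ord0 i) = fun y => y
  ord0 (rshift d1 i)).
  exact: coord_continuous.
by apply/funext => y; rewrite mxE.
Qed.

Lemma row_mx_right_continuous (u : 'rV[R]_d1) :
  continuous (fun z : 'rV[R]_d2 => row_mx u z).
Proof.
have pc : continuous (fun z : 'rV[R]_d2 => (u, z)).
  by apply: continuous_pair; [exact: cst_continuous|move=> z; exact: cvg_id].
exact: continuous_compose pc row_mx_continuous.
Qed.

(** Only the last block is varied, with the first one fixed at [lsubmx y]. *)
Lemma interior_rsubmx (B : set 'rV[R]_(d1 + d2)) (A : set 'rV[R]_d2) (y : 'rV[R]_(d1 +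
  d2)) :
  (forall z, B z -> A (rsubmx z)) -> B° y -> A° (rsubmx y).
Proof.
move=> BA By.
have By' : nbhs (row_mx (lsubmx y) (rsubmx y)) B by rewrite hsubmxK.
have := @row_mx_right_continuous (lsubmx y) (rsubmx y) _ By'.
rewrite /interior nbhs_filterE /=.
by apply: filterS => z /BA; rewrite row_mxKr.
Qed.

End block_matrices.

Section unit_interval.
Context {R : realType}.

Lemma itv_val_bounds (t : unit_itv R) : 0 <= itv_val t <= 1.
Proof. by have := set_valP t; rewrite /= in_itv. Qed.

Lemma itv_val_continuous : continuous (@itv_val R).
Proof. exact: initial_continuous. Qed.

Lemma to_unit_itvK (r : R) : 0 <= r <= 1 -> itv_val (to_unit_itv r) = r.
Proof.
move=> r01; rewrite /itv_val /to_unit_itv /insubd insubT ?inE /= ?in_itv//=.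
Qed.

Lemma itv_valK (t : unit_itv R) : to_unit_itv (itv_val t) = t.
Proof. by apply: val_inj; exact: to_unit_itvK (itv_val_bounds t). Qed.

Lemma to_unit_itv_continuous (X : topologicalType) (theta : X -> R) :
  (forall x, 0 <= theta x <= 1) -> continuous theta ->
  continuous (fun x => to_unit_itv (theta x)).
Proof.
move=> t01 ct; apply: continuous_comp_initial.
rewrite (_ : _ \o _ = theta)//; apply/funext => x.
exact: to_unit_itvK.
Qed.

(** [to_unit_itv] sends everything outside of [0, 1] to 0 and so jumps at 1; preceded by [clamp] it
    is continuous on the whole line. *)
Definition clamp (r : R) : R := Num.max 0 (Num.min 1 r).

Lemma clamp_bounds r : 0 <= clamp r <= 1.
Proof. by rewrite le_max lexx /= ge_max ler01 ge_min lexx. Qed.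

Lemma clamp_id r : 0 <= r <= 1 -> clamp r = r.
Proof. by move=> /andP[r0 r1]; rewrite /clamp min_r// max_r. Qed.

Lemma clamp_continuous : continuous clamp.
Proof.
move=> r; apply: continuous_max; first exact: cvg_cst.
by apply: continuous_min; [exact: cvg_cst|exact: cvg_id].
Qed.

Lemma unit_itv_compact : compact [set: unit_itv R].
Proof.
have -> : [set: unit_itv R] = @to_unit_itv R @` `[0 : R, 1].
  apply/seteqP; split=> // t _; exists (itv_val t); last exact: itv_valK.
  by rewrite /= in_itv /= itv_val_bounds.
apply: continuous_compact; last exact: segment_compact.
apply: (@within_eq _ _ _ (fun r => to_unit_itv (clamp r))).
  by move=> r /=; rewrite in_itv /= => r01; rewrite clamp_id.
apply: continuous_subspaceT.
exact: to_unit_itv_continuous clamp_bounds clamp_continuous.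
Qed.

(* Both charts of [0,1] are given by an affine involution of [0,1], namely [t]
   or [1 - t]. *)
Lemma itv_atlasP c : itv_atlas R c -> exists alpha s : R -> R,
  [/\ involutive alpha, forall x h w, alpha (x + h * w) = alpha x + h * s w,
      continuous alpha /\ continuous s,
      forall r, (0 <= alpha r <= 1) = (0 <= r <= 1) &
      [/\ chart_dom c = [set t | alpha (itv_val t) < 1],
          forall t, chart_map c t = const_mx (alpha (itv_val t)) &
          forall y, chart_inv c y = to_unit_itv (alpha (y ord0 ord0))]].
Proof.
move=> [->|->].
  by exists id, id; split=> //; split=> r; exact: cvg_id.
exists (fun r => 1 - r), (fun r => - r); split.
- by move=> r; rewrite opprB addrC subrK.
- by move=> x h w; rewrite mulrN opprD addrA.
- split=> r; last exact: (@tvs_cvgN _ R^o).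
  by apply: (@tvs_cvgD _ R^o); [exact: cvg_cst|exact: (@tvs_cvgN _ R^o)].
- by move=> r; rewrite subr_ge0 gerBl andbC.
split=> //; apply/seteqP; split=> t /=; by rewrite gtrBl.
Qed.

Lemma itv_charts : corner_charts (itv_atlas R).
Proof.
move=> c /itv_atlasP[alpha [s [aK alin [ca _] a01 [cd cm ci]]]].
have cimg : chart_img c = [set y : 'rV[R]_1 | y ord0 ord0 < 1] `&` orthant R 1.
  apply/seteqP; split=> [_ [t + <-]|y [/= y1 y0]].
    rewrite cd cm /= => t1; split=> [|i]; rewrite mxE//.
    by have := itv_val_bounds t; rewrite -a01 => /andP[].
  have ay : 0 <= alpha (y ord0 ord0) <= 1 by rewrite a01 y0 ltW.
  exists (to_unit_itv (alpha (y ord0 ord0))).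
    by rewrite cd /= to_unit_itvK// aK.
  rewrite cm to_unit_itvK// aK; apply/rowP => i.
  by rewrite mxE (ord1 i).
have oc : open [set y : 'rV[R]_1 | y ord0 ord0 < 1].
  rewrite openE => y /= y1; have := @coord_continuous R 1 1 ord0 ord0 y.
  by move/(_ [set x | x < 1]); apply; exact: lt_nbhsl.
split; last by exists [set y : 'rV[R]_1 | y ord0 ord0 < 1].
split.
- rewrite cd openE => t /= t1.
  have c1 := continuous_compose itv_val_continuous ca.
  by have /(_ [set x | x < 1]) := c1 t; apply; exact: lt_nbhsl.
- move=> t _; rewrite cm ci mxE aK; exact: itv_valK.
- apply: continuous_subspaceT; apply: rV_continuous => i.
  rewrite (_ : (fun t => chart_map c t ord0 i) = alpha \o (@itv_val R)).
    exact: continuous_compose itv_val_continuous ca.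
  by apply/funext => t; rewrite cm mxE.
apply: (@within_eq _ _ _ (fun y : 'rV[R]_1 => to_unit_itv (clamp (alpha (y ord0 ord0))))).
  rewrite cimg => y [/= y1 y0]; rewrite ci clamp_id//.
  by rewrite a01 y0 ltW.
apply: continuous_subspaceT; apply: to_unit_itv_continuous.
  by move=> y; exact: clamp_bounds.
apply: continuous_compose clamp_continuous.
exact: (continuous_compose (@coord_continuous R 1 1 ord0 ord0) ca).
Qed.

End unit_interval.

Section product_charts.
Context {R : realType} {d1 d2 : nat} {T1 T2 : topologicalType}.
Variables (A1 : set (chart T1 'rV[R]_d1)) (A2 : set (chart T2 'rV[R]_d2)).
Hypotheses (H1 : corner_charts A1) (H2 : corner_charts A2).

Lemma prod_chart_img (c1 : chart T1 'rV[R]_d1) (c2 : chart T2 'rV[R]_d2) :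
  chart_img (prod_chart c1 c2) =
  [set y | chart_img c1 (lsubmx y) /\ chart_img c2 (rsubmx y)].
Proof.
apply/seteqP; split=> [_ [[p1 p2] /= [cp1 cp2] <-]|y /= [[p1 cp1 yE1] [p2 cp2 yE2]]].
  by rewrite /= row_mxKl row_mxKr; split; exact: chart_imgP.
by exists (p1, p2) => //=; rewrite yE1 yE2 hsubmxK.
Qed.

Lemma orthant_prod (y : 'rV[R]_(d1 + d2)) :
  orthant R (d1 + d2) y <-> orthant R d1 (lsubmx y) /\ orthant R d2 (rsubmx y).
Proof.
split=> [y0|[y1 y2] i]; first by split=> i; rewrite mxE.
rewrite -[y]hsubmxK mxE; case: fintype.splitP => j _; [exact: y1|exact: y2].
Qed.

Lemma prod_corner_charts : corner_charts (prod_atlas A1 A2).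
Proof.
move=> _ [c1 [c2 [/H1[[op1 K1 m1 i1] [W1 oW1 cW1]] /H2[[op2 K2 m2 i2] [W2 oW2 cW2]] ->]]].
split; last first.
  exists (@lsubmx R 1 d1 d2 @^-1` W1 `&` @rsubmx R 1 d1 d2 @^-1` W2).
    apply: openI; apply: open_comp => // y _.
      exact: lsubmx_continuous.
    exact: rsubmx_continuous.
  rewrite prod_chart_img cW1 cW2; apply/seteqP; split=> y /=.
    by move=> [[w1 y1] [w2 y2]]; split=> //; apply/orthant_prod.
  by move=> [[w1 w2] /orthant_prod[y1 y2]].
split.
- rewrite openE => -[p1 p2] /= [cp1 cp2]; exists (chart_dom c1, chart_dom c2) => //=.
  by split; exact: open_nbhs_nbhs.
- move=> [p1 p2] /set_mem /= [cp1 cp2]; rewrite row_mxKl row_mxKr.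
  by rewrite K1 ?K2 ?inE.
- apply: (@within_comp _ _ _ _ setT (fun p => (chart_map c1 p.1, chart_map c2 p.2)) (fun
  p => row_mx p.1 p.2)) => //.
    apply: within_pair.
      apply: (within_comp _ m1); last by move=> p [].
      by apply: continuous_subspaceT; exact: continuous_fst.
    apply: (within_comp _ m2); last by move=> p [].
    by apply: continuous_subspaceT; exact: continuous_snd.
  by apply: continuous_subspaceT; exact: row_mx_continuous.
rewrite prod_chart_img; apply: within_pair.
  apply: (within_comp _ i1); last by move=> y [].
  by apply: continuous_subspaceT; exact: lsubmx_continuous.
apply: (within_comp _ i2); last by move=> y [].
by apply: continuous_subspaceT; exact: rsubmx_continuous.
Qed.

Lemma smooth_at_snd (E : tvsType R) (phi : T2 -> E) (p : T1 * T2) :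
  smooth_at A2 phi p.2 -> smooth_at (prod_atlas A1 A2) (phi \o snd) p.
Proof.
move=> s _ [c1 [c2 [Ac1 Ac2 ->]]] [cp1 cp2].
have [U nU CU] := s c2 Ac2 cp2.
exists (@rsubmx R 1 d1 d2 @^-1` U).
  by apply: rsubmx_continuous; rewrite /= row_mxKr.
move=> n; have BA y : (chart_img (prod_chart c1 c2) `&` @rsubmx R 1 d1 d2 @^-1` U) y ->
    (chart_img c2 `&` U) (rsubmx y).
  by rewrite prod_chart_img => -[[_ iy] Uy].
apply: (@Cr_precomp_affine _ _ _ _ _ _ _ (phi \o chart_inv c2) (@rsubmx R 1 d1 d2)
  (@rsubmx R 1 d1 d2)) (CU n) => //.
- exact: rsubmx_continuous.
- exact: rsubmx_continuous.
- by move=> y w h; apply/rowP => i; rewrite !mxE.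
- by move=> y; exact: interior_rsubmx.
Qed.

End product_charts.

(** * The cylinder [0, 1] x M *)

Section cylinder.
Context {R : realType} (M : corner_manifold R).
Let A := cm_atlas M.
Let CA := prod_atlas (itv_atlas R) A.
Let cyl : topologicalType := (unit_itv R * M)%type.

Lemma cyl_charts : corner_charts CA.
Proof. apply: prod_corner_charts; [exact: itv_charts|exact: cm_charts]. Qed.

Lemma cyl_cover (p : cyl) : exists2 c, CA c & chart_dom c p.
Proof.
have [c Ac cp] := cm_cover p.2.
have [t1|t1] := ltP (itv_val p.1) 1.
  exists (prod_chart (itv_chart0 R) c); last by split.
  by exists (itv_chart0 R), c; split=> //; left.
exists (prod_chart (itv_chart1 R) c); last by split=> //=; exact: lt_le_trans t1.
by exists (itv_chart1 R), c; split=> //; right.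
Qed.

Lemma smooth_at_itv_val (E : tvsType R) (a : R^o -> E) (p : cyl) :
  (forall n, Cr n setT a) -> smooth_at CA (fun q => a (itv_val q.1)) p.
Proof.
move=> Ca _ [c1 [c2 [Ac1 Ac2 ->]]] [cp1 cp2].
have [alpha [s [aK alin [calpha cs] a01 [cd cm ci]]]] := itv_atlasP Ac1.
exists setT => [|n]; first exact: filterT.
apply: (@Cr_eq _ _ _ _ _ (a \o (fun y : 'rV[R]_(1 + cm_dim M) => alpha (y ord0 (lshift _
  ord0))))).
  rewrite prod_chart_img => y [[[t ct yE] _] _] /=.
  rewrite -[y ord0 _](_ : lsubmx y ord0 ord0 = _); last by rewrite mxE.
  by rewrite ci -yE cm mxE aK itv_valK.
apply: (@Cr_precomp_affine _ _ _ _ _ setT _ a _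
  (fun y : 'rV[R]_(1 + cm_dim M) => s (y ord0 (lshift _ ord0)))) (Ca n) => //.
- exact: (continuous_compose (@coord_continuous _ _ _ _ _) calpha).
- exact: (continuous_compose (@coord_continuous _ _ _ _ _) cs).
- by move=> y w h; rewrite !mxE alin.
- by move=> y _; rewrite interiorT.
Qed.

Lemma unit_itv_nbhs (t0 : unit_itv R) (P : set (unit_itv R)) : nbhs t0 P ->
  exists2 r : R, 0 < r & forall t, `|itv_val t - itv_val t0| <= r -> P t.
Proof.
move=> nP; have c := to_unit_itv_continuous (@clamp_bounds R) (@clamp_continuous R).
have /c : nbhs (to_unit_itv (clamp (itv_val t0))) P.
  by rewrite clamp_id ?itv_val_bounds// itv_valK.
rewrite nbhs_filterE /= => -[e /= e0 eP].
exists (e / 2) => [|t tt]; first by rewrite divr_gt0.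
rewrite -[t]itv_valK -[itv_val t]clamp_id ?itv_val_bounds//; apply: eP => /=.
by rewrite distrC (le_lt_trans tt)// ltr_pdivrMr// ltr_pMr// ltr1n.
Qed.

Lemma cyl_bump : has_bumps CA.
Proof.
move=> p P [[P1 P2] /= [nP1 nP2] PP].
have [r r0 rP1] := unit_itv_nbhs nP1.
have [b2 [Q2 [[sb2 b201] b21 cQ2 clQ2 [QP2 bQ2]]]] := cm_bump nP2.
have [beta [Cb b01 bsupp b1]] := bump_rV 1 r0.
pose t0 := itv_val p.1.
pose a (u : R^o) : R^o := beta (const_mx (u - t0)).
have ck : continuous (fun u : R => const_mx (u - t0) : 'rV[R]_1).
  apply: rV_continuous => i.
  rewrite (_ : (fun u : R => _) = (fun u : R => u - t0)); last by apply/funext => u;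
    rewrite mxE.
  by move=> u; apply: cvgB; [exact: cvg_id|exact: cvg_cst].
have Ca n : Cr n setT a.
  apply: (@Cr_precomp_affine _ _ _ _ _ setT _ beta (fun u : R^o => const_mx (u - t0) :
    'rV[R]_1)
    (fun u : R^o => const_mx u)) (Cb n) => //.
  - apply: rV_continuous => i.
    rewrite (_ : (fun u : R^o => _) = id); last by apply/funext => u; rewrite mxE.
    by move=> u; exact: cvg_id.
  - by move=> u w h; apply/rowP => i; rewrite !mxE addrAC.
  - by move=> u _; rewrite interiorT.
have ca : continuous a by move=> u; apply: (within_at openT Logic.I (Cr_continuous (Ca
  0%N))).
pose b (q : cyl) : R^o := a (itv_val q.1) *: b2 q.2.
pose Q1 := [set t : unit_itv R | `|itv_val t - t0| <= r].
have clQ1 : closed Q1.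
  have cs : continuous (fun u : R => `|u - t0|).
    by move=> u; apply: cvg_norm; apply: cvgB; [exact: cvg_id|exact: cvg_cst].
  have c := continuous_compose (@itv_val_continuous R) cs.
  by apply: (@closed_comp _ _ _ [set x : R | x <= r]) => [t _|]; [exact: c|exact:
    closed_le].
have cQ1 : compact Q1 by exact: subclosed_compact clQ1 unit_itv_compact _.
exists b, (Q1 `*` Q2); split.
- split=> q.
    apply: (@smooth_at_scale _ _ _ _ R^o); first exact: smooth_at_itv_val.
    by apply: smooth_at_snd; exact: sb2.
  have /andP[a0 a1] := b01 (const_mx (itv_val q.1 - t0)).
  have /andP[c0 c1] := b201 q.2.
  by rewrite /b /GRing.scale /= mulr_ge0//= mulr_ile1.
- have na : \forall t \near p.1, a (itv_val t) = 1.
    have b1' : nbhs (const_mx (itv_val p.1 - t0) : 'rV[R]_1) [set v | beta v = 1].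
      by rewrite subrr (_ : const_mx 0 = 0)//; apply/rowP => i; rewrite !mxE.
    exact: (continuous_compose (@itv_val_continuous R) ck b1').
  exists ([set t | a (itv_val t) = 1], [set x | b2 x = 1]) => //=.
  by move=> q [/= aq bq]; rewrite /b aq bq scale1r.
- exact: compact_setX.
- rewrite (_ : Q1 `*` Q2 = fst @^-1` Q1 `&` snd @^-1` Q2)//.
  apply: closedI; apply: closed_comp => // q _; [exact: cvg_fst|exact: cvg_snd].
split=> [q [Qq1 Qq2]|q].
  by apply: PP; split; [exact: rP1|exact: QP2].
rewrite /b /GRing.scale /= mulf_eq0 negb_or => /andP[aq bq].
split=> /=; last exact: bQ2.
by have := bsupp _ ord0 aq; rewrite mxE => /ltW.
Qed.

(** The section z |-> (t, z) takes interior points to interior points when 0 < t < 1, as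
    [Cr_precomp_affine] requires; for t = 0 and t = 1 its image lies in the boundary. *)
Lemma smooth_at_slice (E : tvsType R) (phi : cyl -> E) (t : unit_itv R) (x : M) :
  0 < itv_val t < 1 -> smooth_at CA phi (t, x) ->
  smooth_at A (fun y => phi (t, y)) x.
Proof.
move=> /andP[t0 t1] s c Ac cx.
have CAc : CA (prod_chart (itv_chart0 R) c).
  by exists (itv_chart0 R), c; split=> //; left.
have [U nU CU] := s _ CAc (conj t1 cx : chart_dom (prod_chart (itv_chart0 R) c) (t, x)).
pose sec (z : 'rV[R]_(cm_dim M)) : 'rV[R]_(1 + cm_dim M) := row_mx (const_mx (itv_val
  t)) z.
have sec_lin : forall z w (h : R), sec (z + h *: w) = sec z + h *: row_mx 0 w.
  move=> z w h; rewrite /sec scale_row_mx add_row_mx scaler0 addr0//.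
have csec := @row_mx_right_continuous R 1 (cm_dim M).
have img0 : chart_img (itv_chart0 R) (const_mx (itv_val t)).
  by exists t.
pose B := chart_img c `&` [set z | U° (sec z)].
exists [set z | U° (sec z)].
  by apply: csec; exact: nbhs_interior.
move=> n; apply: (@Cr_eq _ _ _ _ _ ((phi \o chart_inv (prod_chart (itv_chart0 R) c)) \o
  sec)).
  by move=> z _ /=; rewrite row_mxKl row_mxKr mxE itv_valK.
have BA z : B z -> (chart_img (prod_chart (itv_chart0 R) c) `&` U) (sec z).
  move=> [iz Uz]; split; last exact: interior_subset.
  by rewrite prod_chart_img /= row_mxKl row_mxKr.
apply: (@Cr_precomp_affine _ _ _ _ _ _ _ _ sec (fun w => row_mx 0 w)) (CU n).
- exact: csec.
- exact: csec.
- exact: sec_lin.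
- exact: BA.
move=> z Bz; rewrite interiorI; split; last first.
  by have [] := interior_subset Bz.
rewrite prod_chart_img.
have n0 : nbhs (lsubmx (sec z)) [set y : 'rV[R]_1 | 0 < y ord0 ord0 < 1].
  rewrite row_mxKl; have := @coord_continuous R 1 1 ord0 ord0 (const_mx (itv_val t)).
  move=> /(_ [set r | 0 < r < 1]); apply; rewrite /= mxE.
  by apply: filterS2 (lt_nbhsr t0) (lt_nbhsl t1) => r /= -> ->.
have n1 : nbhs (rsubmx (sec z)) (chart_img c).
  by rewrite row_mxKr; apply: filterS Bz => w [].
have m0 : \forall y \near sec z, [set u : 'rV[R]_1 | 0 < u ord0 ord0 < 1] (lsubmx y).
  exact: lsubmx_continuous n0.
have m1 : \forall y \near sec z, chart_img c (rsubmx y).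
  exact: rsubmx_continuous n1.
apply: filterS2 m0 m1 => y /= /andP[y0 y1] iy; split=> //.
exists (to_unit_itv (lsubmx y ord0 ord0)); rewrite /= to_unit_itvK// ?(ltW y0) ?(ltW
  y1)//.
by apply/rowP => i; rewrite mxE (ord1 i).
Qed.

Variable N : lc_manifold R.

Lemma smooth_at_N_snd (f : M -> N) (p : cyl) :
  smooth_at_N A f p.2 -> smooth_at_N CA (f \o snd) p.
Proof.
move=> [E [e [Ae ep s]]]; exists E, e; split=> //.
by apply: (@smooth_at_snd _ _ _ _ _ _ _ _ (chart_map e \o f)).
Qed.

Lemma smooth_at_N_slice (F : cyl -> N) (t : unit_itv R) (x : M) :
  0 < itv_val t < 1 -> smooth_at_N CA F (t, x) -> smooth_at_N A (fun y => F (t, y)) x.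
Proof.
move=> t01 [E [e [Ae ep s]]]; exists E, e; split=> //.
exact: (smooth_at_slice t01 s).
Qed.

(** As [0, 1] is compact, the sets [0, 1] x [S m] exhaust the cylinder, and the places to be
    smoothed or kept can be prescribed by the time t alone. *)
Lemma cyl_smoothing (F : cyl -> N) (C U : set (unit_itv R)) :
  connected [set: M] -> continuous F -> closed C -> open U -> C `<=` U ->
  exists G : cyl -> N, [/\ continuous G, forall p, ~ U p.1 -> G p = F p,
    forall p, smooth_at_N CA F p -> smooth_at_N CA G p &
    forall p, C p.1 -> smooth_at_N CA G p].
Proof.
move=> cM cF clC oU CU.
have [S [cS clS SS covS]] : exists S : nat -> set M, [/\ forall m, compact (S m),
    forall m, closed (S m), forall m, S m `<=` (S m.+1)° & forall x, exists m, S m x].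
  apply: compact_exhaustion => //; [exact: cm_hausdorff|exact: cm_paracompact|].
  move=> p; have [b [Q [_ b1 cQ _ [_ bQ]]]] := cm_bump (filterT : nbhs p setT).
  by exists Q => //; apply: filterS b1 => q bq; apply: bQ; rewrite bq oner_eq0.
apply: (@exhaustion_smoothing _ _ _ _ cyl_charts cyl_cover cyl_bump _ _
  (fun m => [set: unit_itv R] `*` S m) (fst @^-1` C) (fst @^-1` U)) => //.
- by move=> m; apply: compact_setX => //; exact: unit_itv_compact.
- move=> m; rewrite (_ : _ `*` _ = snd @^-1` S m).
    by apply: closed_comp => // q _; exact: cvg_snd.
  by apply/seteqP; split=> q // [].
- move=> m [t x] [_ /= Sx]; exists (setT, S m.+1) => //=.
  by split; [exact: filterT|exact: SS].
- by move=> [t x]; have [m Sx] := covS x; exists m.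
- by apply: closed_comp => // q _; exact: cvg_fst.
- by apply: open_comp => // q _; exact: cvg_fst.
- by move=> p; exact: CU.
Qed.

End cylinder.

(** * Homotopies *)

Section homotopies.
Context {R : realType} (M : corner_manifold R) (N : lc_manifold R).
Hypothesis Mconn : connected [set: M].

Lemma open_itv_val (P : set R) : open P -> open [set t : unit_itv R | P (itv_val t)].
Proof. by move=> oP; apply: open_comp => // t _; exact: itv_val_continuous. Qed.

Lemma closed_itv_val (P : set R) : closed P -> closed [set t : unit_itv R | P (itv_val
  t)].
Proof. by move=> cP; apply: closed_comp => // t _; exact: itv_val_continuous. Qed.

Lemma itv_val0 : itv_val (itv0 R) = 0. Proof. by []. Qed.
Lemma itv_val1 : itv_val (itv1 R) = 1. Proof. by []. Qed.

Lemma reparametrize_continuous (F : unit_itv R * M -> N) (theta : R -> R) :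
  continuous F -> continuous theta -> (forall r, 0 <= r <= 1 -> 0 <= theta r <= 1) ->
  continuous (fun p : unit_itv R * M => F (to_unit_itv (theta (itv_val p.1)), p.2)).
Proof.
move=> cF ct t01; apply: (continuous_compose _ cF).
apply: continuous_pair; last exact: continuous_snd.
have c : continuous (fun t : unit_itv R => to_unit_itv (theta (itv_val t))).
  apply: to_unit_itv_continuous; first by move=> t; apply/t01/itv_val_bounds.
  exact: continuous_compose (@itv_val_continuous R) ct.
exact: continuous_compose (@continuous_fst _ _) c.
Qed.

Lemma homotopic_to_smooth (f : M -> N) : continuous f ->
  exists2 g : M -> N, smooth_map (cm_atlas M) g & homotopic R f g.
Proof.
move=> cf.
have cF : continuous (f \o snd : unit_itv R * M -> N).
  exact: continuous_compose (@continuous_snd _ _) cf.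
have [|||G [cG GF _ Gs]] := @cyl_smoothing R M N _ [set t | 2^-1 <= itv_val t]
  [set t | 0 < itv_val t] Mconn cF.
- exact: (closed_itv_val (@closed_ge _ _)).
- exact: (open_itv_val (@open_gt _ _)).
- by move=> t /=; apply: lt_le_trans; rewrite invr_gt0.
have half01 (r : R) : 0 <= r <= 1 -> 0 <= r / 2 <= 1 by lra.
have halfc : continuous (fun r : R => r / 2).
  by move=> r; apply: cvgM; [exact: cvg_id|exact: cvg_cst].
have v2 : itv_val (to_unit_itv (2^-1 : R)) = 2^-1 by rewrite to_unit_itvK//; lra.
(* G is smooth for t >= 1/2 and still f at t = 0. Its part over [0, 1/2], stretched to [0, 1], is
   the homotopy from f to the slice at 1/2. *)
exists (fun x => G (to_unit_itv 2^-1, x)).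
  apply: smooth_at_map; first exact: cm_charts.
    apply: (continuous_compose _ cG); apply: continuous_pair.
      exact: cst_continuous.
    by move=> x; exact: cvg_id.
  move=> x; apply: smooth_at_N_slice; first by rewrite v2; lra.
  by apply: Gs; rewrite /= v2.
exists (fun p => G (to_unit_itv (itv_val p.1 / 2), p.2)); split.
- exact: (reparametrize_continuous cG halfc half01).
- by move=> x /=; rewrite itv_val0 mul0r GF//= to_unit_itvK ?lexx ?ler01// ltxx.
- by move=> x /=; rewrite itv_val1 mul1r.
Qed.

Lemma homotopic_smoothly (f g : M -> N) :
  smooth_map (cm_atlas M) f -> smooth_map (cm_atlas M) g ->
  homotopic R f g -> smoothly_homotopic f g.
Proof.
move=> sf sg [F [cF F0 F1]].
(* The function 2 r - 1/2 takes [1/4, 3/4] onto [0, 1], so the new homotopy is stationary on the two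
   outer quarters. *)
pose theta (r : R) := clamp (2 * r - 2^-1).
have theta_c : continuous theta.
  apply: (continuous_compose _ (@clamp_continuous R)) => r.
  by apply: cvgB; [apply: cvgM; [exact: cvg_cst|exact: cvg_id]|exact: cvg_cst].
have theta0 r : r <= 4^-1 -> theta r = 0.
  move=> r4; rewrite /theta /clamp; apply/max_idPl.
  by rewrite ge_min; apply/orP; right; lra.
have theta1 r : 3 / 4 <= r -> theta r = 1.
  by move=> r4; rewrite /theta /clamp min_l ?max_r//; lra.
pose F' (p : unit_itv R * M) := F (to_unit_itv (theta (itv_val p.1)), p.2).
have cF' : continuous F'.
  by apply: reparametrize_continuous => // r _; exact: clamp_bounds.
have to0 : to_unit_itv (0 : R) = itv0 R by rewrite -itv_val0 itv_valK.
have to1 : to_unit_itv (1 : R) = itv1 R by rewrite -itv_val1 itv_valK.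
have F'0 t x : itv_val t <= 4^-1 -> F' (t, x) = f x.
  by move=> t4; rewrite /F' /= theta0// to0.
have F'1 t x : 3 / 4 <= itv_val t -> F' (t, x) = g x.
  by move=> t4; rewrite /F' /= theta1// to1.
(* Before 1/4 and after 3/4 the homotopy is locally f or g, hence smooth, and [Gs] preserves this;
   the closed middle part is smoothed, and at the times 0 and 1 nothing changes. *)
have [|||G [cG GF Gs GC]] := @cyl_smoothing R M N F'
  [set t | 4^-1 <= itv_val t <= 3 / 4] [set t | 0 < itv_val t < 1] Mconn cF'.
- rewrite (_ : mkset _ = [set t | 4^-1 <= itv_val t] `&` [set t | itv_val t <= 3 / 4]).
    by apply: closedI; [exact: (closed_itv_val (@closed_ge _ _))|exact: (closed_itv_val
      (@closed_le _ _))].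
  by apply/seteqP; split=> t /= /andP.
- rewrite (_ : mkset _ = [set t | 0 < itv_val t] `&` [set t | itv_val t < 1]).
    by apply: openI; [exact: (open_itv_val (@open_gt _ _))|exact: (open_itv_val
      (@open_lt _ _))].
  by apply/seteqP; split=> t /= /andP.
- by move=> t /=; lra.
exists G; split.
- apply: smooth_at_map => //; first exact: cyl_charts.
  have near_sub (p : unit_itv R * M) (P : set R) (h : M -> N) : open P -> P (itv_val
    p.1) ->
      smooth_map (cm_atlas M) h ->
      (forall q : unit_itv R * M, P (itv_val q.1) -> F' q = h q.2) ->
      smooth_at_N (prod_atlas (itv_atlas R) (cm_atlas M)) F' p.
    move=> oP Pp sh Fh; apply: (@smooth_at_N_near _ _ _ _ (@cyl_charts R M) _ (h \o snd)).
      have nP : nbhs p.1 [set t | P (itv_val t)].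
        by apply: open_nbhs_nbhs; split=> //; exact: open_itv_val.
      exists ([set t | P (itv_val t)], setT) => [|q [/= Pq _]]; first by split=> //;
        exact: filterT.
      by rewrite Fh.
    by apply: smooth_at_N_snd; apply: smooth_map_at => //; exact: cm_charts.
  move=> p; have [t1|t1] := ltP (itv_val p.1) 4^-1.
    apply: Gs; apply: (near_sub p _ f (@open_lt R 4^-1) t1 sf).
    by move=> [t x] /= /ltW; exact: F'0.
  have [t2|t2] := ltP (3 / 4) (itv_val p.1); last by apply: GC; rewrite /= t1.
  apply: Gs; apply: (near_sub p _ g (@open_gt R (3 / 4)) t2 sg).
  by move=> [t x] /= /ltW; exact: F'1.
- by move=> x; rewrite GF /= ?itv_val0 ?ltxx// F'0// itv_val0; lra.
- by move=> x; rewrite GF /= ?itv_val1 ?ltxx ?andbF// F'1// itv_val1; lra.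
Qed.

End homotopies.

Theorem corollary0p14 (R : realType) (M : corner_manifold R)
    (N : lc_manifold R) (Mconn : connected [set: M]) :
  (forall f : M -> N, continuous f ->
     exists2 g : M -> N, smooth_map (cm_atlas M) g & homotopic R f g) /\
  (forall f g : M -> N,
     smooth_map (cm_atlas M) f -> smooth_map (cm_atlas M) g ->
     (homotopic R f g <-> smoothly_homotopic f g)).
Proof.
split=> [f|f g sf sg]; first exact: homotopic_to_smooth.
split=> [|[F [[cF _] F0 F1]]]; first exact: homotopic_smoothly.
by exists F.
Qed.
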